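(* Let $\mu,\nu$ be partitions of a positive integer $n$, and let $\mu^{[1]}=(\mu_2,\mu_3,\ldots)$. Then $$B^\nu_\mu(t)=\sum_{\lambda\in\mathcal P^{\nu}_{n-\mu_1}}\ \sum_{\tau\models\mu_1}(1-t)^{l(\tau)}\,B(\lambda,\nu-\tau)\,B^\lambda_{\mu^{[1]}}(t),$$ where $\mathcal P^\nu_{m}=\{\lambda\vdash m:\lambda\subset\nu\}$ and $\tau$ runs over the compositions $\tau=(\tau_1,\ldots,\tau_{l(\nu)})$ of $\mu_1$ into $l(\nu)$ nonnegative parts.
   Context: Let $V$ be the ring of symmetric functions over $\mathbb Q(t)$, with power sums $p_n$, $p_\lambda=p_{\lambda_1}p_{\lambda_2}\cdots$. For a partition $\lambda$ with $m_i(\lambda)$ parts equal to $i$, put $z_\lambda=\prod_{i\ge1}i^{m_i(\lambda)}m_i(\lambda)!$ and $z_\lambda(t)=z_\lambda/\prod_{i=1}^{l(\lambda)}(1-t^{\lambda_i})$. Equip $V$ with the bilinear form $\langle p_\lambda,p_\mu\rangle=\delta_{\lambda\mu}z_\lambda(t)$. Define $q_n\in V$ by $\sum_{n\ge0}q_nz^n=\exp\left(\sum_{n\ge1}\frac{1-t^n}{n}p_nz^n\right)$ and $q_\mu=q_{\mu_1}q_{\mu_2}\cdots$. The Hall-Littlewood functions are $Q_\lambda(t)=\prod_{i<j}\frac{1-R_{ij}}{1-tR_{ij}}\,q_{\lambda_1}\cdots q_{\lambda_l}$, where the raising operator $R_{ij}$ raises the $i$-th index by 1 and lowers the $j$-th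 index by 1. For partitions $\mu,\nu$ of the same weight, $B^\nu_\mu(t)=\langle Q_\nu(t),q_\mu\rangle$ (so $B^\emptyset_\emptyset=1$). For a partition or composition $\tau$ (a tuple of nonnegative integers), $l(\tau)$ is the number of nonzero parts; $\lambda\subset\nu$ means $\lambda_i\le\nu_i$ for all $i$. Straightening: For an integer tuple $\alpha=(\alpha_1,\ldots,\alpha_l)$ and an index $i$ with $\alpha_i<\alpha_{i+1}$ put $d=\alpha_{i+1}-\alpha_i$. For $0\le a\le\lfloor d/2\rfloor$ let $S_{i,a}\alpha=(\alpha_1,\ldots,\alpha_{i-1},\alpha_{i+1}-a,\alpha_i+a,\alpha_{i+2},\ldots,\alpha_l)$, with attached coefficient (relative to $\alpha$) $$C(S_{i,a})=\begin{cases}t& a=0,\\ t^{a+1}-t^{a-1}&1\le a<\lfloor d/2\rfloor,\\ t^{a+\epsilon}-t^{a-1}& a=\lfloor d/2\rfloor\ge1,\end{cases}$$ where $\epsilon\in\{0,1\}$ is the parity of $d$. For $\underline i=(i_1,\ldots,i_r)$ and $\underline a=(a_1,\ldots,a_r)$, $r\ge0$, write $S_{\underline i,\underline a}\alpha=S_{i_1,a_1}\cdots S_{i_r,a_r}\alpha$, the operations being applied successively from right to left, each being defined on the tuple to which it is applied, and $C(S_{\underline i,\underline a})=C(S_{i_1,a_1})\cdots C(S_{i_r,a_r})$, each factor computed relative to the tuple to which the operation is applied (the empty sequence has coefficient 1). For an integer tuple $\alpha$ and a partition $\lambda$, $B(\lambda,\alpha)=\sum_{\underline i,\underline a} C(S_{\underline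 i,\underline a})$, summed over all $\underline i,\underline a$ with $S_{\underline i,\underline a}\alpha=\lambda$, where $\lambda$ is padded with zeros to the length of $\alpha$ (and $B(\lambda,\alpha)=0$ if there are none).
   Formalization: B(λ,α) is summed not over all sequences (i,a) but only over those whose index i at each step is the ascent chosen by a fixed rule, for any such rule; summing over all sequences makes the identity false, e.g. for ν=(1,1,1), μ=(3). *)

(* Defs.v *)
From HB Require Import structures.
From mathcomp Require Import all_boot all_order all_algebra.
From mathcomp Require Import finmap.
From mathcomp Require Import boolp classical_sets functions cardinality fsbigop.
From mathcomp Require Import monalg ring.

Set Implicit Arguments.
Unset Strict Implicit.
Unset Printing Implicit Defensive.

Import Order.TTheory GRing.Theory Num.Theory.
Local Open Scope classical_set_scope.
Local Open Scope ring_scope.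

Definition Qt : fieldType := {fraction {poly rat}}.

Definition tvar : Qt := tofrac ('X : {poly rat}).

Definition is_part (n : nat) (s : seq nat) : bool :=
  [&& sorted geq s, 0%N \notin s & sumn s == n].

Definition subpart (la nu : seq nat) : Prop :=
  forall i : nat, (nth 0%N la i <= nth 0%N nu i)%N.

Definition len (tau : seq nat) : nat := count (fun x => x != 0%N) tau.

(* All definitions are given over a field F with a parameter t; the case of
   interest is F = Qt, t = tvar.
   The ring of symmetric functions over Q(t) is freely generated, as a
   commutative Q(t)-algebra, by the power sums p_1, p_2, ...; it is realised as
   the polynomial algebra in countably many variables, the variable of index i
   being p_(i.+1). *)
Definition symfun (F : fieldType) : comAlgType F := {malg F[{cmonom nat}]}.

Definition psum (F : fieldType) (n : nat) : symfun F := << (ucm n.-1 : {cmonom nat}) >>.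

Definition psum_part (F : fieldType) (la : seq nat) : symfun F :=
  \prod_(i <- la) psum F i.

Definition zee (la : seq nat) : nat :=
  \prod_(i <- undup la) (i ^ count_mem i la * (count_mem i la)`!)%N.

Definition zee_t (F : fieldType) (t : F) (la : seq nat) : F :=
  (zee la)%:R / \prod_(i <- la) (1 - t ^+ i).

(* The partition la such that the monomial m is psum_part la. *)
Definition mon_part (m : {cmonom nat}) : seq nat :=
  sort geq (flatten [seq nseq (m i) i.+1 | i <- finsupp m]).

(* The bilinear form for which the psum_part la are orthogonal, with
   <psum_part la, psum_part la> = zee_t t la; see hl_form_psum. *)
Definition hl_form (F : fieldType) (t : F) (f g : symfun F) : F :=
  \sum_(m <- msupp f) f@_m * g@_m * zee_t t (mon_part m).

(* hl_q n is the coefficient of z^n in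
   exp (\sum_(m >= 1) (1 - t^m)/m psum m z^m).
   Since this series has no constant term, neither its terms of degree > n nor
   the powers of exponent > n in exp contribute to that coefficient. *)
Definition hl_q_exponent (F : fieldType) (t : F) (n : nat) : {poly symfun F} :=
  \sum_(1 <= m < n.+1) (((1 - t ^+ m) / m%:R) *: psum F m)%:P * 'X^m.

Definition hl_q (F : fieldType) (t : F) (n : nat) : symfun F :=
  \sum_(k < n.+1) (k`!%:R^-1 : F) *: (hl_q_exponent t n ^+ k)`_n.

Definition hl_q_int (F : fieldType) (t : F) (x : int) : symfun F :=
  if x is Posz n then hl_q t n else 0.

Definition hl_q_part (F : fieldType) (t : F) (mu : seq nat) : symfun F :=
  \prod_(i <- mu) hl_q t i.

Notation index_pair l := {ij : 'I_l * 'I_l | (ij.1 < ij.2)%N}.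

(* The coefficient of R^k in (1 - R) / (1 - t R). *)
Definition raising_coef (F : fieldType) (t : F) (k : nat) : F :=
  if k is k'.+1 then t ^+ k - t ^+ k' else 1.

(* The i-th index after applying \prod_(i < j) R_ij ^ (k ij) to la. *)
Definition raise (la : seq nat) (k : {ffun index_pair (size la) -> nat})
    (i : 'I_(size la)) : int :=
  (nth 0%N la i)%:Z
    + \sum_(ij : index_pair (size la)) (k ij)%:Z *
        (((val ij).1 == i)%:Z - ((val ij).2 == i)%:Z).

Definition hl_Q_term (F : fieldType) (t : F) (la : seq nat)
    (k : {ffun index_pair (size la) -> nat}) : symfun F :=
  (\prod_(ij : index_pair (size la)) raising_coef t (k ij)) *:
    \prod_(i < size la) hl_q_int t (raise k i).

(* \prod_(i < j) (1 - R_ij) / (1 - t R_ij) is expanded into monomials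
   \prod_(i < j) R_ij ^ (k ij) in the raising operators, which act on the tuple
   of indices; only finitely many terms are nonzero (hl_Q_finite) because
   hl_q_int vanishes at negative indices. *)
Definition hl_Q (F : fieldType) (t : F) (la : seq nat) : symfun F :=
  \sum_(k \in [set: {ffun index_pair (size la) -> nat}]) hl_Q_term t k.

Definition hl_B (F : fieldType) (t : F) (nu mu : seq nat) : F :=
  hl_form t (hl_Q t nu) (hl_q_part t mu).

(* The entries of an integer tuple are numbered from 0. *)
Definition ascent (alpha : seq int) (i : nat) : bool :=
  (i.+1 < size alpha)%N && (nth 0 alpha i < nth 0 alpha i.+1).

Definition gap (alpha : seq int) (i : nat) : nat :=
  `|(nth 0 alpha i.+1 - nth 0 alpha i)%R|%N.

Definition S_op (ia : nat * nat) (alpha : seq int) : seq int :=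
  set_nth 0 (set_nth 0 alpha ia.1 (nth 0 alpha ia.1.+1 - ia.2%:Z))
    ia.1.+1 (nth 0 alpha ia.1 + ia.2%:Z).

Definition S_coef (F : fieldType) (t : F) (ia : nat * nat)
    (alpha : seq int) : F :=
  let d := gap alpha ia.1 in
  let a := ia.2 in
  if a == 0%N then t
  else if (a < d./2)%N then t ^+ a.+1 - t ^+ a.-1
  else t ^+ (a + odd d) - t ^+ a.-1.

(* [:: (i_1, a_1); ...; (i_r, a_r)] stands for S_(i_1, a_1) ... S_(i_r, a_r),
   applied from right to left. *)
Definition S_seq (w : seq (nat * nat)) (alpha : seq int) : seq int :=
  foldr S_op alpha w.

Fixpoint S_seq_coef (F : fieldType) (t : F) (w : seq (nat * nat))
    (alpha : seq int) : F :=
  if w is ia :: w' then S_coef t ia (S_seq w' alpha) * S_seq_coef t w' alpha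
  else 1.

(* A straightening procedure chooses, in every tuple that has an ascent, the
   ascent at which the tuple is to be straightened. *)
Definition procedure (pick : seq int -> nat) : Prop :=
  forall alpha i, ascent alpha i -> ascent alpha (pick alpha).

Fixpoint admissible (pick : seq int -> nat) (w : seq (nat * nat))
    (alpha : seq int) : bool :=
  if w is ia :: w' then
    [&& admissible pick w' alpha,
        ia.1 == pick (S_seq w' alpha),
        ascent (S_seq w' alpha) ia.1
      & (ia.2 <= (gap (S_seq w' alpha) ia.1)./2)%N]
  else true.

Definition pad (l : nat) (la : seq nat) : seq int :=
  map Posz (la ++ nseq (l - size la) 0%N).

(* The sum runs over the sequences (i, a) that follow a straightening procedure;
   there are finitely many of them (admissible_finite).
   Letting the ascents vary freely would count the same straightening several
   times: (0, 1, 0, 1) becomes (1, 0, 1, 0) by exchanging either the first two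
   or the last two entries first. *)
Definition B_straight (F : fieldType) (t : F) (pick : seq int -> nat)
    (la : seq nat) (alpha : seq int) : F :=
  \sum_(w \in [set w | admissible pick w alpha
                       /\ S_seq w alpha = pad (size alpha) la])
    S_seq_coef t w alpha.

Definition tuple_sub (nu tau : seq nat) : seq int :=
  [seq x.1%:Z - x.2%:Z | x <- zip nu tau].

Lemma psum_partE (F : fieldType) (la : seq nat) :
  psum_part F la = << (\big[mmul/mone]_(i <- la) ucm i.-1 : {cmonom nat}) >>.
Proof.
rewrite /psum_part; elim: la => [|i la IH]; first by rewrite !big_nil.
rewrite !big_cons IH /psum.
have := fgmulUU (R := F) 1 1 (ucm i.-1 : {cmonom nat})
  (\big[mmul/mone]_(j <- la) ucm j.-1).
by rewrite mulr1 => <-; exact: malgM_def.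
Qed.

Lemma count_mon_part (m : {cmonom nat}) (x : nat) :
  count_mem x (mon_part m) = if x is i.+1 then m i else 0%N.
Proof.
rewrite /mon_part (permP (permEl (perm_sort _ _))) count_flatten -map_comp.
case: x => [|x].
  by rewrite sumnE big_map big1 // => i _ /=; rewrite count_nseq.
rewrite sumnE big_map.
have [xm|xm] := boolP (x \in finsupp m).
  rewrite (big_fsetD1 x) //= count_nseq /= eqxx mul1n big_seq big1 ?addn0 //.
  move=> i; rewrite !inE => /andP[ix _].
  by rewrite count_nseq /= eqSS (negbTE ix).
rewrite big_seq big1; first by apply/esym/eqP; rewrite cmE_eq0.
move=> i im; rewrite /= count_nseq /= eqSS.
by case: eqP => // ix; rewrite -ix im in xm.
Qed.

Lemma mon_partK (n : nat) (la : seq nat) : is_part n la ->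
  mon_part (\big[mmul/mone]_(i <- la) ucm i.-1) = la.
Proof.
move=> /and3P[sla nla _].
have geq_tr : transitive geq by move=> a b c /= ba ac; apply: leq_trans ac ba.
have geq_anti : antisymmetric geq by move=> a b; rewrite /= andbC => /anti_leq.
have geq_tot : total geq by move=> a b; rewrite /= orbC leq_total.
apply: (sorted_eq geq_tr geq_anti) => //; first exact: sort_sorted.
apply/allP => x _ /=; rewrite count_mon_part; case: x => [|x].
  by rewrite eq_sym; apply/eqP/count_memPn.
apply/eqP; elim: la nla {sla} => [|i la IH]; first by rewrite big_nil cm1.
rewrite inE negb_or big_cons => /andP[i0 nla].
rewrite cmM cmU IH //=; case: i i0 => // i _; by rewrite eqSS.
Qed.

Lemma hl_formDl (F : fieldType) (t a : F) (f1 f2 g : symfun F) :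
  hl_form t (a *: f1 + f2) g = a * hl_form t f1 g + hl_form t f2 g.
Proof.
have E (d : {fset {cmonom nat}}) (f : symfun F) : (msupp f `<=` d)%fset ->
    hl_form t f g = \sum_(m <- d) f@_m * g@_m * zee_t t (mon_part m).
  move=> fd; apply: big_fset_incl => // m _ mf.
  by rewrite mcoeff_outdom // !mul0r.
pose d := (msupp (a *: f1 + f2) `|` (msupp f1 `|` msupp f2))%fset.
have d0 : (msupp (a *: f1 + f2) `<=` d)%fset by exact: fsubsetUl.
have d1 : (msupp f1 `<=` d)%fset by rewrite /d fsetUCA fsubsetUl.
have d2 : (msupp f2 `<=` d)%fset by rewrite /d fsetUA fsubsetUr.
rewrite (E _ _ d0) (E _ _ d1) (E _ _ d2) mulr_sumr -big_split; apply: eq_bigr => m _ /=.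
by rewrite mcoeffD mcoeffZ !mulrDl !mulrA.
Qed.

Lemma hl_formC (F : fieldType) (t : F) (f g : symfun F) :
  hl_form t f g = hl_form t g f.
Proof.
have E (f1 g1 : symfun F) : hl_form t f1 g1 =
    \sum_(m <- (msupp f1 `|` msupp g1)%fset)
      f1@_m * g1@_m * zee_t t (mon_part m).
  apply: big_fset_incl; first exact: fsubsetUl.
  by move=> m _ mf; rewrite mcoeff_outdom // !mul0r.
by rewrite !E fsetUC; apply: eq_bigr => m _; rewrite (mulrC f@_m).
Qed.

Lemma hl_form_monom (F : fieldType) (t : F) (m1 m2 : {cmonom nat}) :
  hl_form t << m1 >> << m2 >> = if m1 == m2 then zee_t t (mon_part m1) else 0.
Proof.
have E (z : {cmonom nat} -> F) (g : {malg F[{cmonom nat}]}) :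
    \sum_(m <- msupp (<< m1 >> : {malg F[{cmonom nat}]}))
      << m1 >>@_m * g@_m * z m = g@_m1 * z m1.
  rewrite msuppU oner_eq0 big_seq_fset1.
  have -> : (<< m1 >> : {malg F[{cmonom nat}]})@_m1 = 1 by exact: mcoeffUU.
  by rewrite mul1r.
rewrite /hl_form; apply: etrans (E (fun m => zee_t t (mon_part m)) _) _.
have -> : (<< m2 >> : {malg F[{cmonom nat}]})@_m1 = (m2 == m1)%:R.
  exact: mcoeffU1.
by rewrite eq_sym; case: (m1 == m2); rewrite ?mul1r ?mul0r.
Qed.

Lemma hl_form_psum (F : fieldType) (t : F) (n m : nat) (la mu : seq nat) :
  is_part n la -> is_part m mu ->
  hl_form t (psum_part F la) (psum_part F mu) =
    if la == mu then zee_t t la else 0.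
Proof.
move=> pla pmu; rewrite !psum_partE hl_form_monom (mon_partK pla).
case: (altP (la =P mu)) => [->|ne]; first by rewrite eqxx.
case: eqP => // e; move: ne.
by rewrite -(mon_partK pla) -(mon_partK pmu) e eqxx.
Qed.

Lemma raise_tail (la : seq nat) (k : {ffun index_pair (size la) -> nat})
    (ij : index_pair (size la)) :
  (forall i, 0 <= raise k i) -> (k ij <= sumn la)%N.
Proof.
move=> k0; set j := (val ij).2.
have : 0 <= \sum_(i < size la | (j <= i)%N) raise k i by apply: sumr_ge0.
rewrite /raise big_split /= exchange_big /= (bigD1 ij) //=.
have S0 (p : 'I_(size la)) :
    \sum_(i < size la | (j <= i)%N) (p == i)%:Z = (j <= p)%N%:Z.
  rewrite big_mkcond (bigD1 p) //= eqxx big1 ?addr0; first by case: ifP.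
  by move=> i ip; rewrite eq_sym (negbTE ip); case: ifP.
have S1 (p : index_pair (size la)) :
    \sum_(i < size la | (j <= i)%N)
      (k p)%:Z * (((val p).1 == i)%:Z - ((val p).2 == i)%:Z)
    = (k p)%:Z * ((j <= (val p).1)%N%:Z - (j <= (val p).2)%N%:Z).
  by rewrite -mulr_sumr sumrB !S0.
rewrite S1 leqnn leqNgt (valP ij) /= sub0r mulrN1.
set A := (X in 0 <= X + (_ + _)); set C := (X in 0 <= A + (_ + X)).
have A_le : A <= (sumn la)%:Z.
  rewrite /A sumnE (big_nth 0%N) big_mkord -natz natr_sum big_mkcond /=.
  by apply: ler_sum => i _; rewrite natz; case: ifP.
have C_le : C <= 0.
  rewrite /C; apply: sumr_le0 => p _; rewrite S1 mulr_ge0_le0 //.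
  rewrite subr_le0 lez_nat; have [jp|//] := leqP j (val p).1.
  by rewrite (leq_trans jp) // ltnW // (valP p).
move=> h; rewrite -lez_nat -subr_ge0; apply: le_trans h _.
rewrite addrA [A + _]addrC -addrA addrC lerD2r.
by rewrite -[leRHS]addr0 lerD.
Qed.

Lemma hl_Q_finite (F : fieldType) (t : F) (la : seq nat) :
  finite_set [set k : {ffun index_pair (size la) -> nat} | hl_Q_term t k != 0].
Proof.
pose N := (sumn la).+1.
pose g (f : {ffun index_pair (size la) -> 'I_N}) :
  {ffun index_pair (size la) -> nat} := [ffun ij => f ij : nat].
apply: (@sub_finite_set _ _ (range g)); last exact/finite_image/finite_finset.
move=> k /= kn0; have k0 i : 0 <= raise k i.
  rewrite leNgt; apply: contra kn0 => ki.
  rewrite /hl_Q_term (bigD1 i) //= {1}/hl_q_int.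
  by case: (raise k i) ki => // x _; rewrite mul0r scaler0.
exists [ffun ij => Ordinal (raise_tail ij k0 : (k ij < N)%N)] => //.
by apply/ffunP => ij; rewrite !ffunE.
Qed.

Lemma size_S_op (ia : nat * nat) (alpha : seq int) :
  ascent alpha ia.1 -> size (S_op ia alpha) = size alpha.
Proof.
case/andP => si _; rewrite /S_op !size_set_nth.
by rewrite (maxn_idPr (ltnW si)) (maxn_idPr si).
Qed.

Lemma nth_S_op (ia : nat * nat) (alpha : seq int) (j : nat) :
  nth 0 (S_op ia alpha) j =
    if j == ia.1.+1 then nth 0 alpha ia.1 + ia.2%:Z
    else if j == ia.1 then nth 0 alpha ia.1.+1 - ia.2%:Z
    else nth 0 alpha j.
Proof. by rewrite /S_op !nth_set_nth /= nth_set_nth. Qed.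

Lemma admissible_finite (pick : seq int -> nat) (alpha : seq int) :
  finite_set [set w | admissible pick w alpha].
Proof.
pose m : int := - \sum_(x <- alpha) `|x|.
have m_le j : (j < size alpha)%N -> m <= nth 0 alpha j.
  move=> js; rewrite lerNl (le_trans (ler_norm _)) // normrN.
  rewrite (big_nth 0) big_mkord (bigD1 (Ordinal js)) //= lerDl.
  by apply: sumr_ge0.
clearbody m; pose M (be : seq int) := \sum_(i < size be) (i%:Z * (nth 0 be i - m)).
have [N] : exists N : nat, M alpha < N%:Z.
  exists (absz (M alpha)).+1; apply: le_lt_trans (ler_norm _) _.
  by rewrite -abszE ltz_nat.
move: m_le; elim: N alpha => [|N IH] alpha m_le MN.
  suff : 0 <= M alpha by rewrite leNgt MN.
  apply: sumr_ge0 => i _; rewrite mulr_ge0 // subr_ge0; exact: m_le.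
pose i := pick alpha.
have [asc|nasc] := boolP (ascent alpha i); last first.
  apply: (@sub_finite_set _ _ [set [::]]); last exact: finite_set1.
  elim/last_ind => // w ia _ /= adm; exfalso; move: adm.
  elim: w => [|x w IHw] /=; last by case/and4P=> /IHw.
  by case/and3P => /eqP ->; rewrite (negbTE nasc).
pose T a := (rcons^~ (i, a)) @` [set w | admissible pick w (S_op (i, a) alpha)].
apply: (@sub_finite_set _ _
  ([set [::]] `|` \bigcup_(a in `I_(gap alpha i)./2.+1) T a)).
  elim/last_ind => [_|w ia _ adm]; first by left.
  have {adm} : admissible pick w (S_op ia alpha) /\
      [&& ia.1 == i, ascent alpha ia.1 & (ia.2 <= (gap alpha ia.1)./2)%N].
    move: adm; rewrite /=; elim: w => [|x w IHw] /=; first by move=> ->.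
    rewrite /S_seq foldr_rcons => /and4P[/IHw[-> ->] -> -> ->].
    by [].
  case: ia => j a [adm /= /and3P[/eqP ji _ aj]]; right; exists a.
    by rewrite /= ltnS -ji.
  by exists w; rewrite ?ji // -ji.
rewrite finite_setU; split; first exact: finite_set1.
apply: bigcup_finite => [|a /= ad]; first exact: finite_II.
apply: finite_image; have sz := size_S_op (ia := (i, a)) asc.
have /andP[si lt_i] := asc.
have gE : (gap alpha i)%:Z = nth 0 alpha i.+1 - nth 0 alpha i.
  by rewrite /gap abszE ger0_norm // subr_ge0 ltW.
have a_lt : a%:Z < nth 0 alpha i.+1 - nth 0 alpha i.
  rewrite -gE ltz_nat; move: ad; rewrite ltnS => /leq_ltn_trans; apply.
  by rewrite -divn2 ltn_Pdiv // -ltz_nat gE subr_gt0.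
apply: IH.
  move=> j; rewrite sz nth_S_op /= => js.
  have mi := m_le _ (ltnW si).
  case: eqP => _; first by rewrite (le_trans mi) // lerDl.
  case: eqP => _; last exact: m_le.
  by rewrite (le_trans mi) // lerBrDr addrC -lerBrDr ltW.
suff : M (S_op (i, a) alpha) < M alpha.
  by move: MN; rewrite -[N.+1]addn1 PoszD ltzD1 => leN lt; exact: lt_le_trans leN.
pose oi := Ordinal (ltnW si); pose oi1 := Ordinal si.
have ne : oi1 != oi by rewrite -val_eqE /= neq_ltn ltnSn orbT.
rewrite /M sz (bigD1 oi) // (bigD1 oi1) //= [ltRHS](bigD1 oi) // (bigD1 oi1) //=.
rewrite !addrA !nth_S_op /= eqxx eqn_leq ltnn andbF eqxx.
rewrite [X in _ + X < _](eq_bigr (fun j : 'I_(size alpha) =>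
  j%:Z * (nth 0 alpha j - m))) ?ltrD2r; last first.
  move=> j /andP[ji ji1]; rewrite nth_S_op /=.
  by rewrite -!val_eqE /= in ji ji1; rewrite (negbTE ji) (negbTE ji1).
set x := nth 0 alpha i in a_lt *; set y := nth 0 alpha _ in a_lt *.
rewrite -subr_gt0 -[i.+1]addn1 PoszD.
have -> : i%:Z * (x - m) + (i%:Z + 1) * (y - m) -
  (i%:Z * (y - a%:Z - m) + (i%:Z + 1) * (x + a%:Z - m)) = y - x - a%:Z by ring.
by rewrite subr_gt0.
Qed.

(* Main.v *)
Require Import Defs.
From HB Require Import structures.
From mathcomp Require Import all_boot all_order all_algebra.
From mathcomp Require Import finmap.
From mathcomp Require Import boolp classical_sets functions cardinality fsbigop.
From mathcomp Require Import monalg ring zify.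

Set Implicit Arguments.
Unset Strict Implicit.
Unset Printing Implicit Defensive.

Import Order.TTheory GRing.Theory Num.Theory.
Local Open Scope classical_set_scope.
Local Open Scope ring_scope.

(** The identity comes from two facts about the adjoint of multiplication by q_m.

    The adjoint of multiplication by p_n is n / (1 - t^n) d/dp_n, so the adjoints
    of the q_m have generating series exp (sum_n z^n d/dp_n), which is the algebra
    morphism p_n |-> p_n + z^n.  It sends q_x to q_x + (1 - t) sum_(a >= 1)
    q_(x - a) z^a, and comparing coefficients of z^m in a product gives
    [form_qprod]: the adjoint of q_m sends q_x1 ... q_xl to the sum of
    (1 - t)^l(tau) q_(x - tau) over the compositions tau of m.  Raising operators
    translate tuples of indices and therefore commute with subtracting tau, so the
    same expansion holds for Q_x, where x is any integer tuple ([form_Q_tuple]).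
    With m = mu_1 and x = nu this reduces the claim to expanding Q_(nu - tau) in
    the Q_la.

    For that, let P be Q with the factor of R = R_(i,i+1) left out.  Then
    (1 - t R) Q = (1 - R) P ([raised_sub_shift]), and P is symmetric in the
    entries i and i+1 ([raised_but_swap]).  Hence the right-hand side changes sign
    when the entries (s, r) become (r - 1, s + 1), which is a four-term relation
    for Q; induction on r - s turns it into the expansion of Q at an ascent with
    the coefficients C(S_(i,a)) ([straighten_pair], [raised_straighten]).
    Repeating this along a straightening procedure ends at tuples without ascent:
    those with a negative last entry give 0, the others are partitions followed by
    zeros, and dropping zeros does not change Q ([straighten_sum],
    [Q_tuple_pad]).  Straightening never leaves the tuples bounded entrywise by nu,
    which is why only the partitions contained in nu occur.

    The series in the raising operators are cut at an exponent N.  Raising with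
    i < j never increases the sums x_j + ... + x_l, and a product of q's vanishes
    at a tuple where such a sum is negative ([raise_ops_tail0]), so every N larger
    than the weight of nu gives the exact value ([raising_sum]). *)

(** * Generalities on linear maps and derivations *)

Lemma leibniz_bilinear (F : fieldType) (V : comAlgType F) (D : {linear V -> V})
    (I : Type) (r s : seq I) (b : I -> V) (c d : I -> F) :
  (forall i j, D (b i * b j) = D (b i) * b j + b i * D (b j)) ->
  let f := \sum_(i <- r) c i *: b i in let g := \sum_(j <- s) d j *: b j in
  D (f * g) = D f * g + f * D g.
Proof.
move=> H /=; rewrite !linear_sum !mulr_suml linear_sum -big_split /=.
apply: eq_bigr => i _; rewrite !mulr_sumr linear_sum -big_split /=.
apply: eq_bigr => j _.
rewrite !linearZ /= -!scalerAl -!scalerAr !linearZ /= H.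
by rewrite !scalerDr !scalerA (mulrC (c i)).
Qed.

Lemma scalar_sum (F : fieldType) (V : lmodType F) (w : V -> F) (I : Type)
    (r : seq I) (P : pred I) (c : I -> F) (x : I -> V) : scalar w ->
  w (\sum_(i <- r | P i) c i *: x i) = \sum_(i <- r | P i) c i * w (x i).
Proof.
move=> w_lin.
have w0 : w 0 = 0 by have := w_lin (-1) 0 0; rewrite scaler0 addr0 mulN1r addNr.
elim: r => [|i r IH]; first by rewrite !big_nil.
by rewrite !big_cons; case: ifP => // _; rewrite w_lin IH.
Qed.

Lemma bilinear_eq (F : fieldType) (V : lmodType F) (I J : Type) (r : seq I)
    (s : seq J) (b : I -> V) (b' : J -> V) (c : I -> F) (d : J -> F)
    (u v : V -> V -> F) :
  (forall g, scalar (u^~ g)) -> (forall f, scalar (u f)) ->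
  (forall g, scalar (v^~ g)) -> (forall f, scalar (v f)) ->
  (forall i j, u (b i) (b' j) = v (b i) (b' j)) ->
  let f := \sum_(i <- r) c i *: b i in let g := \sum_(j <- s) d j *: b' j in
  u f g = v f g.
Proof.
move=> ul ur vl vr E /=.
rewrite (scalar_sum _ _ _ _ (ul _)) (scalar_sum _ _ _ _ (vl _)).
apply: eq_bigr => i _; rewrite (scalar_sum _ _ _ _ (ur _)).
rewrite (scalar_sum _ _ _ _ (vr _)); congr (_ * _).
by apply: eq_bigr => j _; rewrite E.
Qed.

Lemma leibniz_prod (R : comNzRingType) (d : R -> R) l (a : nat -> R) :
  d 1 = 0 -> (forall f g, d (f * g) = d f * g + f * d g) ->
  d (\prod_(i < l) a i) =
  \sum_(i < l) \prod_(j < l) (if j == i :> nat then d (a j) else a j).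
Proof.
move=> d1 dM; elim: l => [|l IH]; first by rewrite !big_ord0.
rewrite big_ord_recr dM IH /= [RHS]big_ord_recr /= mulr_suml; congr (_ + _).
  apply: eq_bigr => i _; rewrite [RHS]big_ord_recr /=.
  by rewrite gtn_eqF //; apply: ltn_ord.
rewrite [RHS]big_ord_recr /= eqxx; congr (_ * _); apply: eq_bigr => j _.
by rewrite ltn_eqF //; apply: ltn_ord.
Qed.

Lemma coef_exp_trunc (R : nzRingType) (A B : {poly R}) i j :
  (forall k, (k <= i)%N -> A`_k = B`_k) -> (A ^+ j)`_i = (B ^+ j)`_i.
Proof.
elim: j i => [|j IH] i AB; first by rewrite !expr0.
rewrite !exprS !coefM; apply: eq_bigr => k _.
have ki : (k <= i)%N by rewrite -ltnS.
rewrite AB // IH // => l lk; apply: AB.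
by rewrite (leq_trans lk) // leq_subr.
Qed.

Lemma coef_exp_small (R : nzRingType) (A : {poly R}) i j :
  A`_0 = 0 -> (i < j)%N -> (A ^+ j)`_i = 0.
Proof.
move=> A0; elim: j i => [//|j IH] i ij.
rewrite exprS coefM big1 // => -[[|k] ki] _ /=; first by rewrite A0 mul0r.
by rewrite IH ?mulr0 //; lia.
Qed.

(** * Power sums, their partial derivatives and the scalar product *)

(** Locked, because unification would otherwise compare two monomials by unfolding
    the finitely supported functions that represent them. *)
HB.lock Definition pmon (F : fieldType) (m : {cmonom nat}) : symfun F := << m >>.
Canonical pmon_unlockable := Unlockable pmon.unlock.

(** The monomial m / p_(k+1).  If p_(k+1) does not occur in m this is m itself, a
    value that only occurs with coefficient 0 below. *)
HB.lock Definition cmpred (m : {cmonom nat}) (k : nat) : {cmonom nat} := divcm m (ucm k).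
Canonical cmpred_unlockable := Unlockable cmpred.unlock.

Lemma cmpredE m k i : cmpred m k i = (m i - (k == i))%N.
Proof. by rewrite unlock divcmE cmU. Qed.

Section SymmetricFunctions.
Context (F : fieldType) (t : F).
Implicit Types (f g h : symfun F) (m : {cmonom nat}).

Local Notation mon := (pmon F).

Lemma monE m : mon m = << m >> :> symfun F.
Proof. by rewrite unlock. Qed.

Lemma mcoeff_mon m k : (mon m)@_k = (m == k)%:R.
Proof. by rewrite monE; exact: mcoeffU1. Qed.

Lemma symfun_mon f : f = \sum_(m <- msupp f) f@_m *: mon m.
Proof.
have E (g : {malg F[{cmonom nat}]}) :
    g = \sum_(m <- msupp g) g@_m *: (<< m >> : {malg F[{cmonom nat}]}).
  rewrite {1}[g]monalgE; apply: eq_bigr => m _; apply/malgP => k.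
  apply: etrans (mcoeffU m (g@_m) k) _.
  rewrite mcoeffZ -mulr_natr; congr (_ * _); exact/esym/mcoeffU1.
rewrite {1}[f]E; by apply: eq_bigr => m _; rewrite monE.
Qed.

Lemma hl_form0l g : hl_form t 0 g = 0.
Proof. by rewrite /hl_form msupp0 big_seq_fset0. Qed.

(** The partial derivative with respect to p_(k+1), the variable of index k. *)
Definition pder (k : nat) f : symfun F :=
  \sum_(m <- msupp f) f@_m *: ((m k)%:R *: mon (cmpred m k)).

Lemma pderEw k (d : {fset {cmonom nat}}) f : (msupp f `<=` d)%fset ->
  pder k f = \sum_(m <- d) f@_m *: ((m k)%:R *: mon (cmpred m k)).
Proof.
move=> fd; apply: big_fset_incl => // m _ mf.
by rewrite mcoeff_outdom // scale0r.
Qed.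

Fact pder_linear k : linear (pder k).
Proof.
move=> a f g.
pose d := (msupp (a *: f + g) `|` (msupp f `|` msupp g))%fset.
have d0 : (msupp (a *: f + g) `<=` d)%fset by exact: fsubsetUl.
have d1 : (msupp f `<=` d)%fset by rewrite /d fsetUCA fsubsetUl.
have d2 : (msupp g `<=` d)%fset by rewrite /d fsetUA fsubsetUr.
rewrite (pderEw _ d0) (pderEw _ d1) (pderEw _ d2) scaler_sumr -big_split /=.
by apply: eq_bigr => m _; rewrite mcoeffD mcoeffZ scalerDl -scalerA.
Qed.

HB.instance Definition _ k :=
  GRing.isLinear.Build F (symfun F) (symfun F) *:%R (pder k) (pder_linear k).

Lemma pder_mon k m : pder k (mon m) = (m k)%:R *: mon (cmpred m k).
Proof.
rewrite (@pderEw k [fset m]%fset); last by rewrite monE; exact: msuppU_le.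
by rewrite big_seq_fset1 mcoeff_mon eqxx scale1r.
Qed.

Lemma monM m1 m2 : mon m1 * mon m2 = mon (mmul m1 m2).
Proof.
rewrite (monE m1) (monE m2) (monE (mmul m1 m2)) [LHS]malgM_def.
have := fgmulUU (R := F) 1 1 m1 m2.
by rewrite mulr1.
Qed.

Lemma cmpredMl m1 m2 (k : nat) : m1 k != 0%N ->
  cmpred (mmul m1 m2) k = mmul (cmpred m1 k) m2.
Proof.
move=> m1k; apply/eqP/cmP => i; rewrite cmpredE !cmM cmpredE.
by case: eqP => [<-|_]; lia.
Qed.

(** By bilinearity it suffices to treat monomials, where both sides are multiples of
    m1 m2 / p_(k+1); a factor not containing p_(k+1) contributes 0. *)
Lemma pderM k f g : pder k (f * g) = pder k f * g + f * pder k g.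
Proof.
have E m1 m2 : pder k (mon m1 * mon m2) =
    pder k (mon m1) * mon m2 + mon m1 * pder k (mon m2).
  rewrite monM (pder_mon k m1) (pder_mon k m2) pder_mon.
  rewrite -scalerAl -scalerAr 2!monM cmM natrD scalerDl.
  have E1 : (m1 k)%:R *: mon (cmpred (mmul m1 m2) k)
      = (m1 k)%:R *: mon (mmul (cmpred m1 k) m2).
    case: (altP (m1 k =P 0%N)) => [->|m1k].
      by rewrite [LHS]scale0r [RHS]scale0r.
    by rewrite cmpredMl.
  have E2 : (m2 k)%:R *: mon (cmpred (mmul m1 m2) k)
      = (m2 k)%:R *: mon (mmul m1 (cmpred m2 k)).
    case: (altP (m2 k =P 0%N)) => [->|m2k].
      by rewrite [LHS]scale0r [RHS]scale0r.
    rewrite (mulmC m1 m2) (cmpredMl m1 m2k) (mulmC (cmpred m2 k) m1).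
    reflexivity.
  rewrite E1 E2.
  reflexivity.
rewrite [f]symfun_mon [g]symfun_mon.
exact: (@leibniz_bilinear F (symfun F) (pder k) _ _ _ mon _ _ E).
Qed.

Lemma pder_psum k n : pder k (psum F n.+1) = (k == n)%:R.
Proof.
have -> : psum F n.+1 = mon (ucm n) by rewrite monE.
rewrite pder_mon cmU eq_sym.
case: eqP => [->|_]; last by rewrite scale0r.
rewrite scale1r; have -> : cmpred (ucm n) n = mone.
  apply/eqP/cmP => i.
  by rewrite cmpredE cmU subnn cm1.
by rewrite monE.
Qed.

(** Allowing any finite set [d] of indices containing the support makes it possible to
    compare m with p_(k+1) m factor by factor. *)
Lemma zee_t_mon (d : {fset nat}) m : (finsupp m `<=` d)%fset ->
  zee_t t (mon_part m) =
  \prod_(i <- d) ((i.+1 ^ m i * (m i)`!)%:R / (1 - t ^+ i.+1) ^+ m i).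
Proof.
move=> md; rewrite -(big_fset_incl _ md); last first.
  move=> i _; rewrite -cmE_neq0 negbK => /eqP ->.
  by rewrite expn0 fact0 expr0 divr1.
rewrite big_split /= prodfV /zee_t; congr (_ * _^-1).
  rewrite -natr_prod; congr (_%:R); rewrite /zee.
  rewrite [LHS](perm_big (map S (finsupp m))); last first.
    apply: uniq_perm; rewrite ?undup_uniq ?(map_inj_uniq succn_inj) ?fset_uniq //.
    move=> x; rewrite mem_undup -has_pred1 has_count count_mon_part.
    case: x => [|x]; first by symmetry; apply/mapP => -[].
    by rewrite (mem_map succn_inj) lt0n cmE_neq0.
  by rewrite big_map; apply: eq_bigr => i _; rewrite count_mon_part.
rewrite /mon_part (perm_big _ (permEl (perm_sort _ _))) big_flatten big_map /=.
by apply: eq_bigr => i _; rewrite big_nseq -Monoid.iteropE.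
Qed.

Lemma zee_t_mon_ucm m k :
  zee_t t (mon_part (mmul (ucm k) m)) =
  k.+1%:R / (1 - t ^+ k.+1) * (m k).+1%:R * zee_t t (mon_part m).
Proof.
pose d := (k |` finsupp m)%fset.
have kd : k \in d by rewrite /d !inE eqxx.
rewrite (@zee_t_mon d m) ?fsubsetUr // (@zee_t_mon d) ?mdomD ?mdomU //.
rewrite (big_fsetD1 k kd) [in RHS](big_fsetD1 k kd) /= cmM cmU eqxx add1n.
have -> : \prod_(i <- (d `\ k)%fset)
    (((i.+1 ^ mmul (ucm k) m i * (mmul (ucm k) m i)`!)%:R : F)
       / (1 - t ^+ i.+1) ^+ mmul (ucm k) m i) =
    \prod_(i <- (d `\ k)%fset)
      ((i.+1 ^ m i * (m i)`!)%:R / (1 - t ^+ i.+1) ^+ m i).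
  rewrite big_seq [RHS]big_seq; apply: eq_bigr => i; rewrite !inE => /andP[ik _].
  by rewrite cmM cmU eq_sym (negbTE ik).
rewrite mulrA; congr (_ * _); rewrite expnS factS exprS invfM.
rewrite !natrM.
move: (k.+1%:R) ((m k).+1%:R) ((_ ^ _)%:R) (_`!%:R) (_^-1) (_^-1) => a b c d' e e'.
ring.
Qed.

Lemma mon_ucm m k :
  psum F k.+1 * mon m = mon (mmul (ucm k) m).
Proof.
have -> : psum F k.+1 = mon (ucm k) by rewrite monE.
exact: monM.
Qed.

Lemma hl_form_mon m1 m2 :
  hl_form t (mon m1) (mon m2) = if m1 == m2 then zee_t t (mon_part m1) else 0.
Proof. by rewrite !monE; exact: hl_form_monom. Qed.

Lemma hl_form_scalar g : scalar (fun f => hl_form t f g).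
Proof. by move=> a f1 f2; exact: hl_formDl. Qed.

Lemma hl_form_scalar_r f : scalar (hl_form t f).
Proof. by move=> a g1 g2; rewrite !(hl_formC t f) hl_formDl. Qed.

Lemma hl_formZl a f g : hl_form t (a *: f) g = a * hl_form t f g.
Proof. by rewrite -[a *: f]addr0 hl_formDl hl_form0l addr0. Qed.

(** Monomials are orthogonal, so the adjoint of multiplication by p_(k+1) is read off
    from the ratio of the norms of p_(k+1) m and m ([zee_t_mon_ucm]): its factor m k + 1
    is the one produced by the derivative. *)
Lemma hl_form_psumM k f g :
  hl_form t (psum F k.+1 * f) g =
  k.+1%:R / (1 - t ^+ k.+1) * hl_form t f (pder k g).
Proof.
pose u f g := hl_form t (psum F k.+1 * f) g.
pose v f g := k.+1%:R / (1 - t ^+ k.+1) * hl_form t f (pder k g).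
suff E m1 m2 : u (mon m1) (mon m2) = v (mon m1) (mon m2).
  rewrite [f]symfun_mon [g]symfun_mon.
  apply: (@bilinear_eq F (symfun F) _ _ (msupp f) (msupp g) mon mon
            (mcoeff^~ f) (mcoeff^~ g) u v _ _ _ _ E).
  - by move=> h a f1 f2; rewrite /u mulrDr -scalerAr hl_formDl.
  - by move=> h a f1 f2; exact: hl_form_scalar_r.
  - by move=> h a f1 f2; rewrite /v hl_formDl mulrDr mulrCA.
  - by move=> h a f1 f2; rewrite /v linearP hl_form_scalar_r mulrDr mulrCA.
rewrite /u /v mon_ucm hl_form_mon pder_mon.
rewrite hl_formC hl_formZl hl_formC hl_form_mon.
case: (altP (m2 k =P 0%N)) => [m2k|m2k].
  rewrite m2k mul0r mulr0; case: eqP => // e.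
  by move: m2k; rewrite -e cmM cmU eqxx.
have -> : (mmul (ucm k) m1 == m2) = (m1 == cmpred m2 k).
  apply/eqP/eqP => [<-|->]; apply/eqP/cmP => i.
    by rewrite cmpredE cmM cmU addKn.
  by rewrite cmM cmU cmpredE subnKC //; case: eqP => // <-; rewrite lt0n.
case: eqP => [e|_]; last by rewrite !mulr0.
have -> : m2 k = (m1 k).+1 by rewrite e cmpredE eqxx subn1 prednK // lt0n.
rewrite zee_t_mon_ucm; exact: esym (mulrA _ _ _).
Qed.
End SymmetricFunctions.

(** * The series with logarithm linear in the power sums *)

Definition prod_at (R : comNzRingType) (q : int -> R) (l : nat)
    (x : nat -> int) : R := \prod_(i < l) q (x i).

(** The recursion on the first entry is the one that extracts a coefficient from a
    product of polynomials, see [coef_skew_prod]. *)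
Fixpoint comps (l m : nat) : seq (seq nat) :=
  if l is l'.+1 then
    flatten [seq [seq a :: tau | tau <- comps l' (m - a)] | a <- iota 0 m.+1]
  else if m == 0%N then [:: [::]] else [::].

Lemma compsS l m : comps l.+1 m =
  flatten [seq [seq a :: tau | tau <- comps l (m - a)] | a <- iota 0 m.+1].
Proof. by []. Qed.

Lemma mem_comps l m tau :
  (tau \in comps l m) = (size tau == l) && (sumn tau == m).
Proof.
elim: l m tau => [|l IH] m tau.
  by case: m => [|m]; case: tau => [|a tau].
apply/flatten_mapP/andP => [[a]|].
  rewrite (mem_iota 0 m.+1) => am /mapP[tau' + ->].
  rewrite IH => /andP[/eqP /= -> /eqP ->]; split => //; apply/eqP; lia.
case: tau => [[]//|a tau] /= [/eqP[sz] /eqP sm].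
exists a; first by rewrite (mem_iota 0 m.+1); lia.
by apply: map_f; rewrite IH sz eqxx /=; apply/eqP; lia.
Qed.

Lemma uniq_comps l m : uniq (comps l m).
Proof.
elim: l m => [|l IH] m; first by case: m.
apply: allpairs_uniq_dep => [|a _|]; [exact: iota_uniq|exact: IH|].
by move=> [a tau] [b sigma] _ _ /= [-> ->].
Qed.

(** The arguments about the q_n only use that symmetric functions form an algebra
    containing elements p_n, with derivations D dual to them and a form for which D is
    adjoint to multiplication by the p_n; they are carried out for any such algebra. *)
Section ExponentialSeries.
Context (F : fieldType) (V : comAlgType F) (t : F) (p : nat -> V).

Definition q_exponent (n : nat) : {poly V} :=
  \sum_(1 <= m < n.+1) (((1 - t ^+ m) / m%:R) *: p m)%:P * 'X^m.

Definition q_coef (n : nat) : V :=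
  \sum_(k < n.+1) (k`!%:R^-1 : F) *: (q_exponent n ^+ k)`_n.

Definition q_coef_int (x : int) : V := if x is Posz n then q_coef n else 0.

Lemma coef_q_exponent n i : (q_exponent n)`_i =
  if (0 < i <= n)%N then ((1 - t ^+ i) / i%:R) *: p i else 0.
Proof.
rewrite /q_exponent coef_sum.
under eq_bigr => m _ do rewrite mul_polyC coefZ coefXn mulr_natr mulrb.
rewrite -big_mkcond /=; under eq_bigl => m do rewrite eq_sym.
case: (ltnP 0 i) => [i0|]; last first.
  rewrite leqn0 => /eqP ->; rewrite big_nat_cond big1 // => m.
  by move=> /andP[/andP[m0 _] /eqP e]; rewrite e in m0.
case: (leqP i n) => [ni|ni] /=; last first.
  rewrite big_nat_cond big1 // => m /andP[/andP[_ mn] /eqP e].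
  by move: mn; rewrite e ltnS leqNgt ni.
by rewrite big_nat1_eq i0 ltnS ni.
Qed.

(** Both truncations in the definition of [q_coef] can be relaxed, which makes q_n for
    different n coefficients of one and the same exponential. *)
Lemma q_coefE n M J : (n <= M)%N -> (n <= J)%N ->
  q_coef n = \sum_(k < J.+1) (k`!%:R^-1 : F) *: (q_exponent M ^+ k)`_n.
Proof.
move=> nM nJ; rewrite -(subnKC nJ) -addSn big_split_ord /=.
rewrite [X in _ = _ + X]big1 => [|k _]; last first.
  by rewrite coef_exp_small ?scaler0 ?coef_q_exponent // addSn leq_addr.
rewrite addr0; apply: eq_bigr => k _; congr (_ *: _).
apply: coef_exp_trunc => i ni; rewrite !coef_q_exponent ni.
by rewrite (leq_trans ni nM).
Qed.

Lemma q_coef0 : q_coef 0 = 1.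
Proof. by rewrite /q_coef big_ord1 expr0 coef1 fact0 invr1 scale1r. Qed.

Hypothesis pcharF0 : [pchar F] =i pred0.

Lemma natS_neq0 k : k.+1%:R != 0 :> F.
Proof. by rewrite ((pcharf0P F).1 pcharF0). Qed.

(** A derivation L of the exponential series multiplies it by the image of the
    exponent; here w lists the coefficients of that image.  It is applied with L = n,
    that is z d/dz on the coefficient of z^n, and with L = d/dp_k. *)
Lemma q_coef_derivation (L : {linear V -> V}) n (w : nat -> V) :
  L (n == 0%N)%:R = 0 ->
  (forall j, L (q_exponent n ^+ j.+1)`_n =
     j.+1%:R *: \sum_(i < n) w i * (q_exponent n ^+ j)`_(n - i.+1)) ->
  L (q_coef n) = \sum_(i < n) w i * q_coef (n - i.+1).
Proof.
move=> L1 Lj; rewrite {1}/q_coef linear_sum big_ord_recl /= linearZ /= expr0 coef1.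
rewrite L1 scaler0 add0r.
under eq_bigr => j _ do rewrite /bump leq0n add1n linearZ /= Lj.
rewrite (eq_bigr (fun j : 'I_n => \sum_(i < n)
   (j`!%:R^-1 : F) *: (w i * (q_exponent n ^+ j)`_(n - i.+1)))); last first.
  move=> j _; rewrite -scaler_sumr scalerA; congr (_ *: _).
  rewrite factS natrM invfM mulrC mulrA mulfV ?mul1r //.
  exact: natS_neq0.
rewrite exchange_big /=; apply: eq_bigr => i _.
have n0 : (0 < n)%N by apply: leq_ltn_trans (ltn_ord i).
rewrite (@q_coefE (n - i.+1) n n.-1) ?leq_subr //; last by lia.
rewrite (prednK n0) mulr_sumr; apply: eq_bigr => j _.
by rewrite scalerAr.
Qed.

(** The operator z d/dz cancels the denominators of the exponent. *)
Lemma deriv_q_exponent n : 'X * (q_exponent n)^`() =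
  \sum_(i < n) ((1 - t ^+ i.+1) *: p i.+1)%:P * 'X^(i.+1).
Proof.
apply/polyP => k; rewrite coefXM coef_deriv coef_q_exponent coef_sum.
under eq_bigr => m _ do rewrite mul_polyC coefZ coefXn mulr_natr mulrb.
case: k => [|k] /=; first by rewrite big1.
case: (ltnP k n) => kn; last first.
  rewrite mul0rn big1 // => i _; case: eqP => // -[e].
  by move: (ltn_ord i); rewrite -e ltnNge kn.
rewrite (bigD1 (Ordinal kn)) //= eqxx big1 => [|i ik]; last first.
  case: eqP => // -[e]; case/eqP: ik; exact: val_inj.
rewrite addr0 -scaler_nat scalerA mulrCA mulfV ?mulr1 //.
exact: natS_neq0.
Qed.

Lemma q_coef_newton n : n%:R *: q_coef n =
  \sum_(i < n) ((1 - t ^+ i.+1) *: p i.+1) * q_coef (n - i.+1).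
Proof.
apply: (@q_coef_derivation (GRing.scale n%:R) n
  (fun i => (1 - t ^+ i.+1) *: p i.+1)) => [|j] /=.
  by case: eqP => [->|_]; rewrite ?scale0r ?scaler0.
have -> : n%:R *: (q_exponent n ^+ j.+1)`_n =
    ('X * (q_exponent n ^+ j.+1)^`())`_n :> V.
  by rewrite coefXM coef_deriv; case: n => [|n] /=; rewrite ?scale0r ?scaler_nat.
rewrite deriv_exp mulrnAr coefMn scaler_nat mulrA deriv_q_exponent mulr_suml.
rewrite coef_sum; congr (_ *+ _); apply: eq_bigr => i _.
by rewrite -mulrA coefCM coefXnM ltnNge (ltn_ord i).
Qed.

Context (D : nat -> {linear V -> V}).
Hypothesis DM : forall k f g, D k (f * g) = D k f * g + f * D k g.
Hypothesis Dp : forall k n, D k (p n.+1) = (k == n)%:R.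

Lemma D1 k : D k 1 = 0.
Proof.
have := DM k 1 1; rewrite !mulr1 mul1r => /eqP.
by rewrite -subr_eq0 opprD addrA subrr sub0r oppr_eq0 => /eqP.
Qed.

Lemma map_polyDM k (A B : {poly V}) :
  map_poly (D k) (A * B) = map_poly (D k) A * B + A * map_poly (D k) B.
Proof.
apply/polyP => i; rewrite coefD !coefM coef_map_id0 ?linear0 // coefM.
rewrite linear_sum -big_split /=; apply: eq_bigr => j _.
by rewrite DM !coef_map_id0 ?linear0.
Qed.

Lemma map_polyD_exp k (A : {poly V}) j :
  map_poly (D k) (A ^+ j.+1) = map_poly (D k) A * A ^+ j *+ j.+1.
Proof.
elim: j => [|j IH]; first by rewrite expr1 expr0 mulr1.
by rewrite exprS map_polyDM IH mulrnAr mulrCA -exprS -mulrS.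
Qed.

Definition pcoef k : F := (1 - t ^+ k.+1) / k.+1%:R.

(** The derivative of the exponent with respect to p_(k+1) is [pcoef k] z^(k+1). *)
Lemma D_q_coef k n : D k (q_coef n) =
  if (k < n)%N then pcoef k *: q_coef (n - k.+1) else 0.
Proof.
rewrite (@q_coef_derivation (D k) n (fun i => if i == k then (pcoef k)%:A else 0)).
- case: (ltnP k n) => kn; last first.
    rewrite big1 // => i _; case: eqP => [e|_]; last by rewrite mul0r.
    by move: (ltn_ord i); rewrite e ltnNge kn.
  rewrite (bigD1 (Ordinal kn)) //= eqxx -scalerAl mul1r big1 ?addr0 // => i ik.
  by rewrite -val_eqE /= in ik; rewrite (negbTE ik) mul0r.
- by case: eqP => _; rewrite ?D1 ?linear0.
move=> j; rewrite -(coef_map_id0 _ _ (linear0 (D k))) map_polyD_exp coefMn.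
rewrite scaler_nat; congr (_ *+ _); rewrite coefM.
rewrite big_ord_recl coef_map_id0 ?linear0 // coef_q_exponent linear0 mul0r add0r.
apply: eq_bigr => i _; rewrite lift0 coef_map_id0 ?linear0 //.
rewrite coef_q_exponent (ltn_ord i) linearZ /= Dp eq_sym.
by case: eqP => [->|_]; rewrite ?scaler0.
Qed.

Lemma q_coef_neg x : x < 0 -> q_coef_int x = 0.
Proof. by case: x. Qed.

Lemma D_q_coef_int k x : D k (q_coef_int x) = pcoef k *: q_coef_int (x - k.+1%:Z).
Proof.
case: x => n; last first.
  by rewrite !q_coef_neg ?linear0 ?scaler0 //; lia.
rewrite D_q_coef; case: (ltnP k n) => kn.
  by have -> : n%:Z - k.+1%:Z = (n - k.+1)%N%:Z by lia.
by rewrite q_coef_neg ?scaler0 //; lia.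
Qed.

Local Notation qprod := (prod_at q_coef_int).

Definition lower_at (x : nat -> int) (i c : nat) : nat -> int :=
  fun j => if j == i then x j - c%:Z else x j.

Lemma D_qprod k l x :
  D k (qprod l x) = pcoef k *: \sum_(i < l) qprod l (lower_at x i k.+1).
Proof.
rewrite /prod_at (@leibniz_prod V (D k) l (fun i => q_coef_int (x i)));
  [|exact: D1|exact: DM].
rewrite scaler_sumr; apply: eq_bigr => i _.
rewrite (bigD1 i) //= [in RHS](bigD1 i) //= /lower_at eqxx D_q_coef_int -scalerAl.
congr (_ *: (_ * _)); apply: eq_bigr => j; rewrite -val_eqE /= => ji.
by rewrite (negbTE ji).
Qed.

(** The coefficients of (1 - t z) / (1 - z). *)
Definition skew_coef (a : nat) : F := if a is 0%N then 1 else 1 - t.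

(** The logarithmic derivative of (1 - t z) / (1 - z), multiplied by z, is
    sum_k (1 - t^k) z^k. *)
Lemma skew_coefE a :
  a%:R * skew_coef a = \sum_(k < a) (1 - t ^+ k.+1) * skew_coef (a - k.+1).
Proof.
case: a => [|a]; first by rewrite mul0r big_ord0.
rewrite big_ord_recr subnn /= mulr1.
rewrite (eq_bigr (fun k : 'I_a => (1 - t) * (1 - t ^+ k.+1))); last first.
  move=> k _; have -> : (a.+1 - k.+1 = (a - k.+1).+1)%N by have := ltn_ord k; lia.
  by rewrite mulrC.
elim: a => [|a IH]; first by rewrite big_ord0 add0r expr1 mul1r.
rewrite big_ord_recr /=.
have -> : a.+2%:R * (1 - t) = a.+1%:R * (1 - t) + (1 - t) by rewrite [in LHS]mulrS; ring.
rewrite IH !exprS; ring.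
Qed.

(** The image of q_x under p_n |-> p_n + z^n, that is, q_x times (1 - t z) / (1 - z)
    with z^a lowering the index by a. *)
Definition skew_poly (x : int) : {poly V} :=
  \poly_(a < if x is Posz n then n.+1 else 0) (skew_coef a *: q_coef_int (x - a%:Z)).

Lemma coef_skew_poly x a : (skew_poly x)`_a = skew_coef a *: q_coef_int (x - a%:Z).
Proof.
rewrite coef_poly; case: ifP => // xa.
rewrite q_coef_neg ?scaler0 //; case: x xa => n; lia.
Qed.

(** The recursion [skew_coefE] in polynomial form; the terms with k >= x vanish, which
    is why any K >= x gives the same sum. *)
Lemma deriv_skew_poly x K : x <= K%:Z -> 'X * (skew_poly x)^`() =
  \sum_(k < K) ((1 - t ^+ k.+1)%:A)%:P * 'X^(k.+1) * skew_poly (x - k.+1%:Z).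
Proof.
move=> xK; apply/polyP => a; rewrite coefXM coef_deriv coef_sum.
under eq_bigr => k _ do rewrite -mulrA coefCM coefXnM -scalerAl mul1r.
have -> : (if a == 0%N then 0 else (skew_poly x)`_a.-1.+1 *+ a.-1.+1) =
    (a%:R * skew_coef a) *: q_coef_int (x - a%:Z).
  case: a => [|a] /=; first by rewrite mul0r scale0r.
  by rewrite coef_skew_poly -scaler_nat scalerA.
case: (lerP a%:Z x) => ax; last first.
  rewrite q_coef_neg ?scaler0 ?big1 //; last by lia.
  move=> k _; case: ltnP => ak; first by rewrite scaler0.
  by rewrite coef_skew_poly q_coef_neg ?scaler0 //; lia.
have aK : (a <= K)%N by lia.
rewrite skew_coefE scaler_suml -(subnKC aK) big_split_ord /=.
rewrite [X in _ = _ + X]big1 ?addr0 => [|k _]; last first.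
  by rewrite ltnS leq_addr scaler0.
apply: eq_bigr => k _; rewrite ltnNge (ltn_ord k) /= coef_skew_poly scalerA.
by congr (_ *: q_coef_int _); have := ltn_ord k; lia.
Qed.

Hypothesis t_nonroot : forall k, (0 < k)%N -> 1 - t ^+ k != 0.
Context (form : V -> V -> F).
Hypothesis form_scalar : forall g, scalar (form^~ g).
Hypothesis formC : forall f g, form f g = form g f.
Hypothesis form_pM : forall k f g,
  form (p k.+1 * f) g = k.+1%:R / (1 - t ^+ k.+1) * form f (D k g).

Lemma form_sum (I : Type) (r : seq I) (P : pred I) (c : I -> F) (f : I -> V) g :
  form (\sum_(i <- r | P i) c i *: f i) g =
  \sum_(i <- r | P i) c i * form (f i) g.
Proof. exact: (scalar_sum _ _ _ _ (form_scalar g)). Qed.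

Lemma formZl c f g : form (c *: f) g = c * form f g.
Proof.
by have := form_sum [:: tt] xpredT (fun=> c) (fun=> f) g; rewrite !big_seq1.
Qed.

(** This lemma and [skew_prod_rec] are the recursion
    m q_m^perp = sum_(k = 1)^m k q_(m-k)^perp d/dp_k
    satisfied by both sides of [form_qprod_skew]: here it comes from the recursion for
    q_m, there from differentiating in z. *)
Lemma form_q_rec m l x h :
  m%:R * form (qprod l x) (q_coef m * h) =
  \sum_(k < m) (1 - t ^+ k.+1) *
     \sum_(i < l) form (qprod l (lower_at x i k.+1)) (q_coef (m - k.+1) * h).
Proof.
rewrite formC -formZl scalerAl q_coef_newton mulr_suml.
under eq_bigr => k _ do rewrite -!scalerAl -mulrA.
rewrite form_sum; apply: eq_bigr => k _; congr (_ * _).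
rewrite form_pM D_qprod formC formZl mulrA.
have -> : k.+1%:R / (1 - t ^+ k.+1) * pcoef k = 1.
  rewrite /pcoef mulrA divfK ?mulfV ?natS_neq0 //; exact: t_nonroot.
rewrite mul1r -[X in form X _](eq_bigr _ (fun i _ => scale1r _)) form_sum.
by apply: eq_bigr => i _; rewrite mul1r.
Qed.

Lemma skew_prod_rec m l (x : nat -> int) :
  m%:R *: (\prod_(i < l) skew_poly (x i))`_m =
  \sum_(k < m) (1 - t ^+ k.+1) *:
     \sum_(i < l) (\prod_(j < l) skew_poly (lower_at x i k.+1 j))`_(m - k.+1).
Proof.
(* A common bound for the number of terms in the derivatives of all factors. *)
have [K [mK xK]] : exists K : nat, (m <= K)%N /\ forall i : 'I_l, x i <= K%:Z.
  exists (m + \sum_(i < l) `|x i|)%N; split; first exact: leq_addr.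
  move=> i; rewrite (bigD1 i) //=; lia.
have -> : m%:R *: (\prod_(i < l) skew_poly (x i))`_m =
    ('X * (\prod_(i < l) skew_poly (x i))^`())`_m :> V.
  by rewrite coefXM coef_deriv; case: m {mK} => [|m] /=; rewrite ?scale0r ?scaler_nat.
rewrite (@leibniz_prod _ (fun f => 'X * f^`()) l (fun i => skew_poly (x i))); last 2 first.
- by rewrite derivC mulr0.
- by move=> f g; rewrite derivM mulrDr mulrA mulrCA.
under [in RHS]eq_bigr => k _ do rewrite scaler_sumr.
rewrite exchange_big coef_sum; apply: eq_bigr => i _.
rewrite (bigD1 i) //= eqxx (deriv_skew_poly (xK i)) mulr_suml coef_sum.
rewrite -(subnKC mK) big_split_ord /= [X in _ + X]big1 ?addr0 => [|k _]; last first.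
  by rewrite -!mulrA coefCM coefXnM ltnS leq_addr mulr0.
apply: eq_bigr => k _.
rewrite -!mulrA coefCM coefXnM ltnNge (ltn_ord k) /= -scalerAl mul1r.
rewrite [in RHS](bigD1 i) //= {1}/lower_at eqxx.
congr (_ *: nth _ (polyseq (_ * _)) _); apply: eq_bigr => j; rewrite -val_eqE /= => ji.
by rewrite /lower_at (negbTE ji).
Qed.

Lemma form_qprod_skew m l (x : nat -> int) h :
  form (qprod l x) (q_coef m * h) = form (\prod_(i < l) skew_poly (x i))`_m h.
Proof.
elim/ltn_ind: m x => -[|m] IH x.
  rewrite q_coef0 mul1r -horner_coef0 horner_prod; congr form.
  apply: eq_bigr => i _.
  by rewrite horner_coef0 coef_skew_poly subr0 scale1r.
apply: (mulfI (natS_neq0 m)); rewrite form_q_rec -formZl skew_prod_rec form_sum.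
apply: eq_bigr => k _; congr (_ * _).
rewrite -[X in form X _](eq_bigr _ (fun i _ => scale1r _)) form_sum.
apply: eq_bigr => i _; rewrite mul1r IH //; lia.
Qed.

Definition sub_tuple (x : nat -> int) (tau : seq nat) : nat -> int :=
  fun i => x i - (nth 0%N tau i)%:Z.

Lemma coef_skew_prod m l (x : nat -> int) :
  (\prod_(i < l) skew_poly (x i))`_m =
  \sum_(tau <- comps l m) (1 - t) ^+ len tau *: qprod l (sub_tuple x tau).
Proof.
elim: l m x => [|l IH] m x.
  rewrite big_ord0 coef1 /=; case: m => [|m] /=; last by rewrite big_nil.
  by rewrite big_seq1 /prod_at big_ord0 scale1r.
rewrite big_ord_recl coefM -(@big_mkord _ _ _ m.+1 xpredT (fun a =>
  (skew_poly (x 0%N))`_a * (\prod_(i < l) skew_poly (x (lift ord0 i)))`_(m - a))).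
rewrite compsS big_flatten big_map /index_iota subn0; apply: eq_bigr => a _.
rewrite (IH _ (fun i => x i.+1)) mulr_sumr big_map; apply: eq_bigr => tau _.
rewrite coef_skew_poly -scalerAl -scalerAr scalerA; congr (_ *: _).
  by rewrite /len /= exprD; case: a.
by rewrite /prod_at big_ord_recl.
Qed.

Lemma form_qprod m l x h :
  form (qprod l x) (q_coef m * h) =
  \sum_(tau <- comps l m)
    (1 - t) ^+ len tau * form (qprod l (sub_tuple x tau)) h.
Proof. by rewrite form_qprod_skew coef_skew_prod form_sum. Qed.
End ExponentialSeries.

(** * Raising operators on integer tuples *)

(** The action of R_ij^k on tuples, which are extended to functions on [nat]. *)
Definition shift (x : nat -> int) (ij : nat * nat) (k : nat) : nat -> int :=
  fun a => x a + k%:Z * ((ij.1 == a)%:Z - (ij.2 == a)%:Z).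

Lemma shift0 x ij : shift x ij 0 = x.
Proof. by apply/funext => a; rewrite /shift mul0r addr0. Qed.

Lemma shiftD x ij k l : shift (shift x ij k) ij l = shift x ij (k + l).
Proof. by apply/funext => a; rewrite /shift PoszD mulrDl addrA. Qed.

Lemma shiftC x ij kl a b :
  shift (shift x ij a) kl b = shift (shift x kl b) ij a.
Proof. by apply/funext => c; rewrite /shift addrAC. Qed.

Section RaisingOperators.
Context (F : fieldType) (t : F) (N : nat).

(** The operator (1 - R_ij) / (1 - t R_ij) with its expansion cut at R_ij^N. *)
Definition raise_op (V : lmodType F) (ij : nat * nat) (g : (nat -> int) -> V)
    (x : nat -> int) : V :=
  \sum_(k < N) raising_coef t k *: g (shift x ij k).

Definition raise_ops (V : lmodType F) (L : seq (nat * nat))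
    (g : (nat -> int) -> V) : (nat -> int) -> V :=
  foldr (@raise_op V) g L.

Section Lmod.
Context (V : lmodType F).
Implicit Types (g : (nat -> int) -> V) (L : seq (nat * nat)).

Lemma raise_opC ij kl g :
  raise_op ij (raise_op kl g) = raise_op kl (raise_op ij g).
Proof.
apply/funext => x; rewrite /raise_op.
under eq_bigr => a _ do rewrite scaler_sumr.
rewrite exchange_big; apply: eq_bigr => b _ /=; rewrite scaler_sumr.
by apply: eq_bigr => a _; rewrite !scalerA mulrC shiftC.
Qed.

Lemma raise_ops_cat L1 L2 g :
  raise_ops (L1 ++ L2) g = raise_ops L1 (raise_ops L2 g).
Proof. exact: foldr_cat. Qed.

Lemma raise_ops_cons ij L g x : raise_ops (ij :: L) g x =
  \sum_(k < N) raising_coef t k *: raise_ops L g (shift x ij k).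
Proof. by []. Qed.

Lemma raise_ops_perm L1 L2 g : perm_eq L1 L2 -> raise_ops L1 g = raise_ops L2 g.
Proof.
elim: L1 L2 => [|ij L1 IH] L2 L12.
  by rewrite perm_sym in L12; rewrite (perm_nilP L12).
have /path.splitPr ijL2 : ij \in L2 by rewrite -(perm_mem L12) mem_head.
case: ijL2 L12 => L3 L4; rewrite -cat_rcons -cats1 -catA => L12.
have L1E : perm_eq L1 (L3 ++ L4).
  by rewrite -(perm_cons ij) (perm_trans L12) // perm_catCA.
rewrite [LHS]/= (IH _ L1E) 3!raise_ops_cat /=.
by elim: L3 {L12 L1E} => [//|kl L3 /= <-]; rewrite raise_opC.
Qed.

(** For a property P preserved by the shifts, only the values of g on P matter. *)
Lemma raise_ops_ext (P : (nat -> int) -> Prop) L g g' x :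
  (forall y ij k, ij \in L -> P y -> P (shift y ij k)) ->
  (forall y, P y -> g y = g' y) -> P x -> raise_ops L g x = raise_ops L g' x.
Proof.
move=> PL Pg; elim: L PL x => [|ij L IH] PL x Px; first exact: Pg.
apply: eq_bigr => k _; congr (_ *: _); apply: IH => [y kl l klL|].
  by apply: PL; rewrite inE klL orbT.
by apply: PL => //; rewrite mem_head.
Qed.

Lemma raise_ops0 L x : raise_ops L (fun=> 0 : V) x = 0.
Proof.
elim: L x => [//|ij L IH] x; rewrite raise_ops_cons big1 // => k _.
by rewrite IH scaler0.
Qed.

Lemma raise_ops_sum L (I : Type) (r : seq I) (c : I -> F)
    (G : I -> (nat -> int) -> V) x :
  raise_ops L (fun y => \sum_(i <- r) c i *: G i y) x =
  \sum_(i <- r) c i *: raise_ops L (G i) x.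
Proof.
elim: L x => [//|ij L IH] x; rewrite raise_ops_cons.
under eq_bigr => k _ do rewrite IH scaler_sumr.
rewrite exchange_big; apply: eq_bigr => i _; rewrite scaler_sumr.
by apply: eq_bigr => k _; rewrite !scalerA mulrC.
Qed.

Lemma raise_ops_translate L g (d : nat -> int) x :
  raise_ops L (fun y => g (fun a => y a - d a)) x =
  raise_ops L g (fun a => x a - d a).
Proof.
elim: L x => [//|ij L IH] x; rewrite !raise_ops_cons.
apply: eq_bigr => k _; rewrite IH.
by congr (_ *: raise_ops _ _ _); apply/funext => a; rewrite /shift addrAC.
Qed.

Lemma raise_ops_reindex L g (s : nat -> nat) x : involutive s ->
  raise_ops L g (x \o s) =
  raise_ops [seq (s ij.1, s ij.2) | ij <- L] (fun y => g (y \o s)) x.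
Proof.
move=> sK; elim: L x => [//|ij L IH] x; rewrite map_cons !raise_ops_cons.
apply: eq_bigr => k _; rewrite -IH; congr (_ *: raise_ops _ _ _); apply/funext => a.
by rewrite /shift /= !(inj_eq (inv_inj sK)).
Qed.
End Lmod.

Lemma raise_ops_scalar (V : lmodType F) (w : V -> F) L g x : scalar w ->
  w (raise_ops L g x) = raise_ops (V := F^o) L (w \o g) x.
Proof.
move=> w_lin; elim: L x => [//|ij L IH] x; rewrite raise_ops_cons.
by rewrite (scalar_sum _ _ _ _ w_lin); apply: eq_bigr => k _; rewrite IH.
Qed.

Definition pairs (l : nat) : seq (nat * nat) :=
  [seq (i, j) | j <- iota 0 l, i <- iota 0 j].

Lemma mem_pairs l ij : (ij \in pairs l) = (ij.1 < ij.2 < l)%N.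
Proof.
apply/allpairsPdep/idP => [[j [i [+ + ->]]]|].
  by rewrite !mem_iota /=; lia.
case: ij => i j /= ij; exists j, i; rewrite !mem_iota; split => //; lia.
Qed.

Lemma uniq_pairs l : uniq (pairs l).
Proof.
apply: allpairs_uniq_dep => [|j _|]; rewrite ?iota_uniq //.
by move=> [j i] [j' i'] _ _ /= [-> ->].
Qed.

Lemma pairsS l : pairs l.+1 = pairs l ++ [seq (i, l) | i <- iota 0 l].
Proof. by rewrite /pairs -[l.+1]addn1 iotaD map_cat flatten_cat /= cats0. Qed.

Definition tail (l : nat) (x : nat -> int) (j : nat) : int :=
  \sum_(j <= a < l) x a.

Lemma sum_eq_nat (j l i : nat) :
  \sum_(j <= a < l) (i == a)%:Z = (j <= i < l)%N%:Z.
Proof.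
rewrite (eq_bigr (fun a => if a == i then 1 else 0)) => [|a _]; last first.
  by rewrite eq_sym; case: eqP.
by rewrite -big_mkcond big_nat1_eq; case: ifP.
Qed.

Lemma tail_shift l x j ij k : tail l (shift x ij k) j =
  tail l x j + k%:Z * ((j <= ij.1 < l)%N%:Z - (j <= ij.2 < l)%N%:Z).
Proof. by rewrite /tail big_split /= -mulr_sumr sumrB !sum_eq_nat. Qed.

Lemma tail_shift_le l x j ij k : ij \in pairs l ->
  tail l (shift x ij k) j <= tail l x j.
Proof.
rewrite mem_pairs => ijl; rewrite tail_shift gerDl mulr_ge0_le0 // subr_le0.
by rewrite lez_nat; case: ij ijl => i i' /=; lia.
Qed.

Section Support.
Context (V : lmodType F) (l : nat) (g : (nat -> int) -> V).
Hypothesis g_supp : forall x a, (a < l)%N -> x a < 0 -> g x = 0.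

(** Raising with i < j never increases the sum of the entries from j on, and a negative
    sum has a negative entry. *)
Lemma raise_ops_tail0 L x j : {subset L <= pairs l} ->
  tail l x j < 0 -> raise_ops L g x = 0.
Proof.
move=> Ll xj; rewrite -[RHS](raise_ops0 V L x).
apply: (@raise_ops_ext V (fun y => tail l y j < 0)) => // [y ij k ijL|y yj].
  by apply: le_lt_trans; apply/tail_shift_le/Ll.
have [/hasP[a]|/hasPn y0] := boolP (has (fun a => y a < 0) (index_iota j l)).
  by rewrite mem_index_iota => /andP[_ al] ya; apply: g_supp ya.
move: yj; rewrite ltNge => /negP[]; rewrite /tail big_seq; apply: sumr_ge0 => a aj.
by rewrite leNgt; apply: y0.
Qed.
End Support.
End RaisingOperators.

(** * Exchanging two adjacent entries *)

(** The coefficient C(S_(i,a)), as a function of the difference d of the two entries. *)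
Definition straight_coef (F : fieldType) (t : F) (d a : nat) : F :=
  if a == 0%N then t
  else if (a < d./2)%N then t ^+ a.+1 - t ^+ a.-1
  else t ^+ (a + odd d) - t ^+ a.-1.

Lemma straight_coef1 (F : fieldType) (t : F) d :
  straight_coef t d.+3 1 = t * t - 1.
Proof. by rewrite /straight_coef; case: d => [|d] /=; rewrite expr0 expr2. Qed.

Lemma straight_coefSS (F : fieldType) (t : F) d a :
  straight_coef t d.+3 a.+2 = t * straight_coef t d.+1 a.+1.
Proof.
rewrite /straight_coef -[d.+3./2]/(d.+1./2.+1) ltnS -[odd d.+3]/(~~ ~~ odd d.+1).
by rewrite negbK /=; case: ifP => _; rewrite ?addSn !exprS; ring.
Qed.

(** The right-hand side of the second hypothesis changes sign under
    (s, r) |-> (r - 1, s + 1).  Adding the hypotheses at these two points gives [step],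
    which expresses q s r through q (s + 1) (r - 1), whose entries differ by d - 2.
    For d = 1 the two points coincide and one has to divide by 2; for d = 2 the point
    (s + 1, r - 1) is on the diagonal and needs no further expansion. *)
Lemma straighten_pair (F : fieldType) (V : lmodType F) (t : F)
    (q p : int -> int -> V) (b : int) :
  (2%:R != 0 :> F) ->
  (forall s r : int, p s r = p r s) ->
  (forall s r : int, r < b ->
     q s r - t *: q (s + 1) (r - 1) = p s r - p (s + 1) (r - 1)) ->
  forall (d : nat) (s r : int), (0 < d)%N -> r = s + d%:Z -> r < b ->
  q s r = \sum_(a < d./2.+1) straight_coef t d a *: q (r - a%:Z) (s + a%:Z).
Proof.
move=> two pC qp.
have step (s r : int) : s < r -> r < b ->
    q s r + q (r - 1) (s + 1) = t *: q r s + t *: q (s + 1) (r - 1).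
  move=> sr rb; rewrite (canRL (subrK _) (qp _ _ rb)).
  have r1b : s + 1 < b by lia.
  rewrite (canRL (subrK _) (qp (r - 1) _ r1b)).
  have -> : r - 1 + 1 = r by lia.
  have -> : s + 1 - 1 = s by lia.
  rewrite (pC (r - 1)) (pC r s) addrACA.
  rewrite -[X in _ + X + _]opprB subrr add0r.
  exact: addrC.
elim/ltn_ind => -[//|[|[|d]]] IH s r _ rE rb.
- rewrite big_ord1 /= subr0 addr0 /straight_coef /=.
  have := step s r; rewrite rE addrK => /(_ (ltac:(lia)) (ltac:(lia))) E.
  by apply: (scalerI two); rewrite !scaler_nat !mulr2n E.
- rewrite 2!big_ord_recl big_ord0 /= !subr0 !addr0 /straight_coef /=.
  have := step s r (ltac:(lia)) rb; have -> : r - 1 = s + 1 by lia.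
  by move/(canRL (addrK _)) => ->; rewrite expr1 expr0 scalerBl scale1r addrA.
have := step s r (ltac:(lia)) rb => /(canRL (addrK _)) ->.
set h := d.+1./2; rewrite -[d.+3./2]/h.+1.
rewrite (IH d.+1 _ (s + 1) (r - 1)) -/h //; try lia.
rewrite [RHS]big_ord_recl subr0 addr0 -addrA; congr (_ + _).
rewrite [RHS]big_ord_recl [in LHS]big_ord_recl subr0 addr0.
rewrite scalerDr scalerA addrAC; congr (_ + _).
  by rewrite straight_coef1 scalerBl scale1r.
rewrite scaler_sumr; apply: eq_bigr => a _; rewrite scalerA !lift0 -straight_coefSS.
by congr (_ *: q _ _); lia.
Qed.

Definition swap_adj (i a : nat) : nat :=
  if a == i then i.+1 else if a == i.+1 then i else a.

Lemma swap_adjK i : involutive (swap_adj i).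
Proof. by move=> a; rewrite /swap_adj; do !case: eqP => //; lia. Qed.

Definition set_pair (x : nat -> int) (i : nat) (s r : int) : nat -> int :=
  fun a => if a == i then s else if a == i.+1 then r else x a.

Lemma set_pair_id x i : set_pair x i (x i) (x i.+1) = x.
Proof.
by apply/funext => a; rewrite /set_pair; do !case: eqP => [->|_].
Qed.

Lemma set_pair_swap x i s r : set_pair x i s r \o swap_adj i = set_pair x i r s.
Proof.
apply/funext => a; rewrite /set_pair /swap_adj /=.
by do !case: eqP => //; lia.
Qed.

Lemma shift_set_pair x i s r k :
  shift (set_pair x i s r) (i, i.+1) k = set_pair x i (s + k%:Z) (r - k%:Z).
Proof.
apply/funext => a; rewrite /set_pair /shift /= ![_ == a]eq_sym.
by case: eqP => [->|_]; [rewrite (ltn_eqF (ltnSn i)); lia|case: eqP; lia].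
Qed.

Lemma tail_set_pair l x i s r : (i.+1 < l)%N ->
  tail l (set_pair x i s r) i.+1 = r + tail l x i.+2.
Proof.
move=> il; rewrite /tail big_ltn // /set_pair (gtn_eqF (ltnSn i)) eqxx.
congr (_ + _); apply: eq_big_nat => a ia.
by rewrite !gtn_eqF //; lia.
Qed.

Section Straightening.
Context (F : fieldType) (t : F) (N : nat) (V : lmodType F) (l : nat).
Context (g : (nat -> int) -> V).
Hypothesis two_neq0 : 2%:R != 0 :> F.
Hypothesis N_gt0 : (0 < N)%N.
Hypothesis g_supp : forall x a, (a < l)%N -> x a < 0 -> g x = 0.
Hypothesis g_swap : forall i x, (i.+1 < l)%N -> g (x \o swap_adj i) = g x.

Definition raised : (nat -> int) -> V := raise_ops t N (pairs l) g.

Definition raised_but (ij : nat * nat) : (nat -> int) -> V :=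
  raise_ops t N (rem ij (pairs l)) g.

Lemma raisedE ij x : ij \in pairs l ->
  raised x = \sum_(k < N) raising_coef t k *: raised_but ij (shift x ij k).
Proof.
move=> ijl; rewrite /raised (raise_ops_perm t N g (perm_to_rem ijl)).
exact: raise_ops_cons.
Qed.

(** Exchanging i and i+1 permutes the pairs p < q other than (i, i+1). *)
Lemma raised_but_swap i x : (i.+1 < l)%N ->
  raised_but (i, i.+1) (x \o swap_adj i) = raised_but (i, i.+1) x.
Proof.
move=> il; rewrite /raised_but raise_ops_reindex; last exact: swap_adjK.
have -> : (fun y => g (y \o swap_adj i)) = g.
  by apply/funext => y; exact: g_swap.
congr (_ x); apply: raise_ops_perm; apply: uniq_perm.
- rewrite map_inj_uniq ?rem_uniq ?uniq_pairs // => -[a b] [c d] [].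
  by move=> /(can_inj (swap_adjK i)) -> /(can_inj (swap_adjK i)) ->.
- by rewrite rem_uniq ?uniq_pairs.
move=> [a b]; rewrite mem_rem_uniq ?uniq_pairs // !inE mem_pairs /=.
apply/mapP/idP => [[[c d]]|].
  rewrite mem_rem_uniq ?uniq_pairs // !inE mem_pairs /= !xpair_eqE.
  move=> cd [-> ->]; move: cd; rewrite /swap_adj.
  by do !case: eqP => //=; lia.
rewrite xpair_eqE => ab; exists (swap_adj i a, swap_adj i b) => /=; last first.
  by rewrite !swap_adjK.
rewrite mem_rem_uniq ?uniq_pairs // !inE mem_pairs /= !xpair_eqE.
by move: ab; rewrite /swap_adj; do !case: eqP => //=; lia.
Qed.

Lemma raised_but_tail0 ij x j : tail l x j < 0 -> raised_but ij x = 0.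
Proof. by apply: raise_ops_tail0 => // kl; exact: mem_rem. Qed.

(** This is (1 - t R) times (1 - R) / (1 - t R) = 1 - R.  Cutting the series at R^N adds
    a multiple of the value at R^N x, which is 0 by the second hypothesis. *)
Lemma raised_sub_shift ij x j : ij \in pairs l ->
  tail l (shift x ij N) j < 0 ->
  raised x - t *: raised (shift x ij 1) =
  raised_but ij x - raised_but ij (shift x ij 1).
Proof.
move=> ijl xj.
have yN := raised_but_tail0 ij xj.
rewrite !(raisedE _ ijl) scaler_sumr.
under [X in _ - X]eq_bigr => k _ do rewrite scalerA shiftD add1n.
case: N N_gt0 yN => // M _ yM.
rewrite big_ord_recl shift0 scale1r -addrA; congr (_ + _).
have -> : \sum_(k < M) raising_coef t (lift ord0 k) *:
      raised_but ij (shift x ij (lift ord0 k)) =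
    \sum_(k < M.+1) raising_coef t k.+1 *: raised_but ij (shift x ij k.+1).
  rewrite [RHS]big_ord_recr /= yM scaler0 addr0.
  exact: eq_bigr.
rewrite -sumrB big_ord_recl big1 => [|k _]; rewrite -scalerBl.
  by rewrite addr0 /= expr1 expr0 mulr1 addrAC subrr add0r scaleN1r.
by rewrite lift0 /= mulrBr -!exprS subrr scale0r.
Qed.

Lemma raised_straighten i x :
  (i.+1 < l)%N -> x i < x i.+1 -> tail l x i.+1 < N%:Z ->
  let d := `|x i.+1 - x i|%N in
  raised x = \sum_(a < d./2.+1) straight_coef t d a *:
    raised (set_pair x i (x i.+1 - a%:Z) (x i + a%:Z)).
Proof.
move=> il xi xN d.
pose q s r := raised (set_pair x i s r).
pose p s r := raised_but (i, i.+1) (set_pair x i s r).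
have pC s r : p s r = p r s.
  by rewrite /p -(raised_but_swap (set_pair x i s r) il) set_pair_swap.
have ijl : (i, i.+1) \in pairs l by rewrite mem_pairs /= ltnSn.
have qp s r : r < N%:Z - tail l x i.+2 ->
    q s r - t *: q (s + 1) (r - 1) = p s r - p (s + 1) (r - 1).
  move=> rN; rewrite /q /p -(shift_set_pair x i s r 1).
  apply: (@raised_sub_shift _ _ i.+1) => //.
  by rewrite shift_set_pair tail_set_pair //; lia.
rewrite -{1}(set_pair_id x i) -/(q (x i) (x i.+1)).
apply: (straighten_pair two_neq0 pC qp); rewrite ?/d; try lia.
have := tail_set_pair x (x i) (x i.+1) il; rewrite set_pair_id; lia.
Qed.
End Straightening.

(** * Expansion of raising operators into monomials *)

Section RaisingExpansion.
Context (F : fieldType) (t : F) (M : nat) (V : lmodType F).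
Context (I : finType) (e : I -> nat * nat) (g : (nat -> int) -> V).
Implicit Types (s : seq I) (k : {ffun I -> 'I_M.+1}).

Definition multi_shift x s k : nat -> int :=
  fun a => x a + \sum_(i <- s) (k i)%:Z * (((e i).1 == a)%:Z - ((e i).2 == a)%:Z).

(** Functions on [I] vanishing outside s stand for the exponents of the operators
    indexed by s, so that the induction on s stays inside one type. *)
Definition supported_in s : pred {ffun I -> 'I_M.+1} :=
  fun k => [forall i, (i \notin s) ==> (k i == ord0)].

Definition update k i (j : 'I_M.+1) : {ffun I -> 'I_M.+1} :=
  [ffun i' => if i' == i then j else k i'].

(** The exponents supported on i :: s with value j at i correspond to the exponents
    supported on s; the form is the side condition of [reindex_onto]. *)
Lemma supported_in_cons i s k j : i \notin s ->
  (supported_in (i :: s) (update k i j) && (update k i j i == j)) &&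
    (update (update k i j) i ord0 == k) = supported_in s k.
Proof.
move=> si; rewrite {2}/update ffunE !eqxx andbT.
apply/andP/forallP => [[/forallP ks /eqP kE] i'|ks]; last first.
  split.
    apply/forallP => i'; rewrite inE negb_or ffunE; apply/implyP => /andP[i'i i's].
    by rewrite (negbTE i'i); apply: (implyP (ks i')).
  apply/eqP/ffunP => i'; rewrite !ffunE; case: eqP => // ->.
  by have /implyP/(_ si)/eqP -> := ks i.
apply/implyP => i's; rewrite -kE !ffunE.
have [//|i'i] := eqVneq i' i.
by have := ks i'; rewrite inE negb_or i's ffunE (negbTE i'i).
Qed.

Lemma raise_ops_expand s x : uniq s ->
  raise_ops t M.+1 [seq e i | i <- s] g x =
  \sum_(k | supported_in s k)
    (\prod_(i <- s) raising_coef t (k i)) *: g (multi_shift x s k).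
Proof.
elim: s x => [|i s IH] x.
  rewrite /= (bigD1 [ffun=> ord0]) /=; last by apply/forallP => i; rewrite ffunE.
  rewrite big_nil scale1r big1 => [|k /andP[/forallP /= k0 /eqP[]]]; last first.
    by apply/ffunP => i; rewrite ffunE; exact/eqP.
  rewrite addr0 => _; congr (g _); apply/funext => a.
  by rewrite /multi_shift big_nil addr0.
rewrite cons_uniq => /andP[si us]; rewrite map_cons raise_ops_cons.
rewrite (partition_big (fun k => k i) xpredT) //=; apply: eq_bigr => j _.
rewrite (reindex_onto (fun k => update k i j) (fun k => update k i ord0)) /=.
  rewrite (eq_bigl (supported_in s)) => [|k]; last exact: supported_in_cons.
  rewrite IH // scaler_sumr; apply: eq_bigr => k _.
  have kE i' : i' \in s -> update k i j i' = k i'.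
    by move=> i's; rewrite ffunE; case: eqP => // e'; rewrite -e' i's in si.
  rewrite scalerA big_cons {1}/update ffunE eqxx; congr (_ * _ *: g _).
    by rewrite big_seq [RHS]big_seq; apply: eq_bigr => i' /kE ->.
  apply/funext => a; rewrite /multi_shift big_cons addrA ffunE eqxx; congr (_ + _).
  by rewrite big_seq [RHS]big_seq; apply: eq_bigr => i' /kE ->.
move=> k /andP[_ /eqP ki]; apply/ffunP => i'; rewrite !ffunE.
by case: eqP => // ->.
Qed.
End RaisingExpansion.

Lemma perm_index_pairs l :
  perm_eq [seq (nat_of_ord (val ij).1, nat_of_ord (val ij).2)
            | ij <- enum {: {ij : 'I_l * 'I_l | (ij.1 < ij.2)%N}}] (pairs l).
Proof.
apply: uniq_perm; rewrite ?uniq_pairs ?map_inj_uniq -?enumT ?enum_uniq //.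
  move=> [[a b] ab] [[c d] cd] /= [] /val_inj ac /val_inj bd.
  by apply: val_inj; rewrite /= ac bd.
move=> [i j]; rewrite mem_pairs; apply/mapP/idP => [[[[a b] /= ab] _ [-> ->]]|].
  by rewrite ab ltn_ord.
move=> /= /andP[ij jl].
exists (exist (fun ij : 'I_l * 'I_l => (ij.1 < ij.2)%N)
  (Ordinal (ltn_trans ij jl), Ordinal jl) ij) => //.
by rewrite mem_enum.
Qed.

Section RaisedProducts.
Context (F : fieldType) (t : F) (V : comAlgType F) (q : int -> V).
Hypothesis q_neg : forall x : int, x < 0 -> q x = 0.

Lemma prod_at_supp l x a : (a < l)%N -> x a < 0 -> prod_at q l x = 0.
Proof.
by move=> al xa; rewrite /prod_at (bigD1 (Ordinal al)) //= q_neg // mul0r.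
Qed.

Lemma prod_at_swap l i x : (i.+1 < l)%N ->
  prod_at q l (x \o swap_adj i) = prod_at q l x.
Proof.
move=> il.
have sl (a : 'I_l) : (swap_adj i a < l)%N.
  have al := ltn_ord a; rewrite /swap_adj; case: eqP => [_ //|_].
  by case: eqP => [_|_ //]; apply: ltn_trans il.
rewrite /prod_at [RHS](reindex_inj (h := fun a => Ordinal (sl a))) //.
by move=> a b [] /(can_inj (swap_adjK i)) /val_inj.
Qed.

(** The operators R_(i,l) lower the entry of index l; when that entry is 0, only their
    constant terms survive. *)
Lemma raised_prod_atS N l x : (0 < N)%N -> q 0 = 1 -> x l = 0 ->
  raised t N l.+1 (prod_at q l.+1) x = raised t N l (prod_at q l) x.
Proof.
move=> N0 q0 xl; rewrite /raised pairsS raise_ops_cat.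
apply: (@raise_ops_ext _ _ _ _ (fun y => y l = 0)) => // [y [i j] k|y yl].
  rewrite mem_pairs /shift /= => /andP[ij jl] ->.
  by rewrite !ltn_eqF ?(ltn_trans ij) // subrr mulr0.
have : {subset iota 0 l <= iota 0 l} by [].
elim: {1 3}(iota 0 l) => [|i s IH] sl.
  by rewrite /= /prod_at big_ord_recr /= yl q0 mulr1.
rewrite map_cons raise_ops_cons; case: N N0 IH => // M _ IH.
rewrite big_ord_recl shift0 scale1r IH => [|a as_]; last first.
  by apply: sl; rewrite inE as_ orbT.
rewrite big1 ?addr0 // => k _; rewrite (@raise_ops_tail0 _ _ _ _ l.+1 _ _ _ _ l).
- by rewrite scaler0.
- by move=> z a; apply: prod_at_supp.
- move=> _ /mapP[a as_ ->]; rewrite mem_pairs /= ltnSn andbT.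
  have : a \in iota 0 l by apply: sl; rewrite inE as_ orbT.
  by rewrite mem_iota.
have il : (i < l)%N by have := sl i (mem_head _ _); rewrite mem_iota.
by rewrite tail_shift /tail big_nat1 yl lift0 /= leqnn ltnSn leqNgt il /=; lia.
Qed.

Lemma raised_prod_at_pad N l m x : (0 < N)%N -> q 0 = 1 ->
  (forall a, (l <= a)%N -> x a = 0) ->
  raised t N (l + m) (prod_at q (l + m)) x = raised t N l (prod_at q l) x.
Proof.
move=> N0 q0 xl; elim: m => [|m IH]; first by rewrite addn0.
by rewrite addnS raised_prod_atS // xl // leq_addr.
Qed.

(** Exponents above the weight of la give a negative index ([raise_tail]), so the sum
    over all exponents reduces to the exponents below N. *)
Lemma raising_sum (la : seq nat) N : (sumn la < N)%N ->
  \sum_(k \in [set: {ffun index_pair (size la) -> nat}])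
     (\prod_(ij : index_pair (size la)) raising_coef t (k ij)) *:
       \prod_(i < size la) q (raise k i) =
  raised t N (size la) (prod_at q (size la)) (fun i => (nth 0%N la i)%:Z).
Proof.
case: N => // M laM.
pose T (k : {ffun index_pair (size la) -> nat}) :=
  (\prod_(ij : index_pair (size la)) raising_coef t (k ij)) *:
    \prod_(i < size la) q (raise k i).
pose emb (f : {ffun index_pair (size la) -> 'I_M.+1}) :
  {ffun index_pair (size la) -> nat} := [ffun ij => f ij : nat].
transitivity (\sum_(f : {ffun index_pair (size la) -> 'I_M.+1}) T (emb f)).
  rewrite [RHS]fsbig_seq ?index_enum_uniq //.
  have -> : [set` index_enum {ffun index_pair (size la) -> 'I_M.+1}] = setT.
    by apply/seteqP; split => // f _ /=; rewrite mem_index_enum.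
  rewrite -(@fsbig_image _ _ _ _ _ setT emb T); last first.
    move=> f f' _ _ /ffunP ff; apply/ffunP => ij; apply: val_inj.
    by have := ff ij; rewrite !ffunE.
  rewrite -[LHS]/(\sum_(k \in setT) T k); apply/esym/fsbig_widen => // k [_ kn].
  apply: contrapT => Tk; apply: kn.
  have k0 i : 0 <= raise k i.
    rewrite leNgt; apply/negP => ki; apply: Tk => /=.
    by rewrite /T (bigD1 i) //= q_neg // mul0r scaler0.
  have kM ij : (k ij < M.+1)%N by apply: leq_ltn_trans laM; exact: raise_tail.
  by exists [ffun ij => Ordinal (kM ij)] => //; apply/ffunP => ij; rewrite !ffunE.
pose e (ij : index_pair (size la)) := (nat_of_ord (val ij).1, nat_of_ord (val ij).2).
rewrite /raised -(raise_ops_perm _ _ _ (perm_index_pairs (size la))).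
rewrite (@raise_ops_expand _ t _ _ _ e) ?enum_uniq //.
rewrite [RHS](eq_bigl xpredT) => [|k]; last first.
  by apply/forallP => ij; rewrite mem_enum.
apply: eq_bigr => k _; rewrite /T big_enum /=; congr (_ *: _).
  by apply: eq_bigr => ij _; rewrite ffunE.
apply: eq_bigr => i _; congr q; rewrite /raise /multi_shift big_enum /=.
by congr (_ + _); apply: eq_bigr => ij _; rewrite ffunE.
Qed.
End RaisedProducts.

(** * Straightening words *)

Section Words.
Context (F : fieldType) (t : F) (pick : seq int -> nat).

Lemma S_seq_rcons w ia alpha : S_seq (rcons w ia) alpha = S_seq w (S_op ia alpha).
Proof. exact: foldr_rcons. Qed.

Lemma S_seq_coef_rcons w ia alpha :
  S_seq_coef t (rcons w ia) alpha =
  S_coef t ia alpha * S_seq_coef t w (S_op ia alpha).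
Proof.
elim: w => [|ib w IH] /=; first by rewrite mulr1.
by rewrite IH S_seq_rcons mulrCA.
Qed.

Lemma admissible_rcons w ia alpha :
  admissible pick (rcons w ia) alpha =
  [&& ia.1 == pick alpha, ascent alpha ia.1,
      (ia.2 <= (gap alpha ia.1)./2)%N & admissible pick w (S_op ia alpha)].
Proof.
elim: w => [|ib w IH] /=; first by rewrite andbT.
by rewrite IH S_seq_rcons -!andbA.
Qed.

Lemma admissible_no_ascent w alpha : ~~ ascent alpha (pick alpha) ->
  admissible pick w alpha = (w == [::]).
Proof.
move=> na; case/lastP: w => [//|w ia].
rewrite admissible_rcons; case: eqP => [->|_]; rewrite ?(negbTE na) /=;
  by case: w.
Qed.

Lemma B_straight_no_ascent la alpha : ~~ ascent alpha (pick alpha) ->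
  B_straight t pick la alpha = (alpha == pad (size alpha) la)%:R.
Proof.
move=> na; rewrite /B_straight; case: eqP => [e|ne]; last first.
  by rewrite fsbig1 // => w [+ E]; rewrite admissible_no_ascent // => /eqP w0;
    case: ne; rewrite -E w0.
have -> : [set w | admissible pick w alpha /\ S_seq w alpha = pad (size alpha) la]
    = [set [::]].
  apply/seteqP; split => w /=; rewrite admissible_no_ascent //.
    by case=> /eqP.
  by move=> ->.
by rewrite fsbig_set1.
Qed.

Lemma pad_no_ascent l la i : sorted geq la -> ~~ ascent (pad l la) i.
Proof.
move=> sla; apply/negP => /andP[]; rewrite /pad size_map => il.
rewrite ltNge => /negP; apply.
have sp : sorted geq (la ++ nseq (l - size la) 0%N).
  elim: la sla {il} => [_|a la IH pla] /=.
    by move: (l - _)%N; case=> // n; elim: n => //= n ->.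
  rewrite cat_path (pla : path geq a la) /=.
  by case: (l - _)%N => //= n; elim: n.
rewrite !(nth_map 0%N) //; last exact: ltnW.
rewrite lez_nat; apply: (sorted_leq_nth _ _ 0%N sp) => //.
- by move=> a b c /= ba ac; apply: leq_trans ac ba.
- exact: leqnn.
- by rewrite inE; apply: ltnW.
Qed.

(** The operation applied first is the last letter of the word, and the procedure
    determines its position; the empty word does not contribute because a partition has
    no ascent. *)
Lemma B_straight_ascent la alpha (i := pick alpha) :
  sorted geq la -> ascent alpha i ->
  B_straight t pick la alpha =
  \sum_(a < (gap alpha i)./2.+1)
     S_coef t (i, val a) alpha * B_straight t pick la (S_op (i, val a) alpha).
Proof.
move=> sla asc.
pose W be := [set w | admissible pick w be /\ S_seq w be = pad (size be) la].
have Wfin be : finite_set (W be).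
  by apply: sub_finite_set (admissible_finite pick be) => w [].
pose r a := fset_set (W (S_op (i, a) alpha)).
have rE a w : (w \in r a) = (w \in W (S_op (i, a) alpha)).
  by rewrite in_fset_set.
pose L := [seq rcons w (i, a) | a <- iota 0 (gap alpha i)./2.+1, w <- r a].
have Lu : uniq L.
  apply: allpairs_uniq_dep => [|a _|]; rewrite ?iota_uniq ?fset_uniq //.
  by move=> [a w] [b v] _ _ /= /rcons_inj[-> ->].
have LE : W alpha = [set` L].
  apply/seteqP; split => w /=.
    case; case/lastP: w => [_ /= E|w [j a]].
      by have := pad_no_ascent (size alpha) i sla; rewrite -E asc.
    rewrite admissible_rcons S_seq_rcons /= => /and4P[/eqP-> _ ai adm] E.
    apply/allpairsPdep; exists a, w; rewrite (mem_iota 0) rE inE /W /=.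
    by rewrite (size_S_op (ia := (i, a)) asc).
  move=> /allpairsPdep[a [v [+ + ->]]]; rewrite (mem_iota 0) rE inE /W /= => ai.
  rewrite (size_S_op (ia := (i, a)) asc) admissible_rcons S_seq_rcons /= eqxx asc.
  by rewrite -ltnS ai.
rewrite /B_straight -/(W alpha) LE -fsbig_seq // /L big_flatten big_map.
rewrite -(big_mkord xpredT (fun a =>
  S_coef t (i, a) alpha * B_straight t pick la (S_op (i, a) alpha))).
rewrite /index_iota subn0; apply: eq_bigr => a _.
rewrite big_map /B_straight -/(W _) fsbig_finite // mulr_sumr.
by apply: eq_bigr => w _; rewrite S_seq_coef_rcons.
Qed.
End Words.

(** * Straightening a tuple into partitions *)

Lemma tail_nth0 l (s : seq nat) : (size s <= l)%N ->
  tail l (fun i => (nth 0%N s i)%:Z) 0 = (sumn s)%:Z.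
Proof.
move=> sl; rewrite /tail (big_cat_nat _ sl) //= [X in _ + X]big_nat_cond.
rewrite [X in _ + X]big1 ?addr0 => [|i /andP[/andP[il _] _]]; last first.
  by rewrite nth_default.
rewrite sumnE -[RHS]natz natr_sum [RHS](big_nth 0%N).
by apply: eq_bigr => i _; rewrite natz.
Qed.

Lemma sorted_geq_pad (s : seq nat) : sorted geq s ->
  s = [seq x <- s | x != 0%N] ++
      nseq (size s - size [seq x <- s | x != 0%N]) 0%N.
Proof.
elim: s => [//|[|a] s IH] ss /=.
  have s0 : all (pred1 0%N) s.
    elim: s ss {IH} => [//|[|b] s IH] //= ss; exact: IH.
  have -> : [seq x <- s | x != 0%N] = [::].
    by apply/eqP; rewrite -size_eq0 size_filter eqn0Ngt -has_count -all_predC;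
      apply: sub_all s0 => x /= ->.
  by congr (_ :: _); rewrite [LHS](all_pred1P _ _ s0).
by rewrite subSS; congr (_ :: _); apply: IH; apply: path_sorted ss.
Qed.

Lemma filter_pad (la : seq nat) m : 0%N \notin la ->
  [seq x <- la ++ nseq m 0%N | x != 0%N] = la.
Proof.
move=> la0; rewrite filter_cat [X in _ ++ X](_ : _ = [::]); last first.
  by elim: m => [|m IH] /=.
by rewrite cats0; apply/all_filterP/allP => x; apply: contraTneq => ->.
Qed.

Lemma pad_inj l la lb : 0%N \notin la -> 0%N \notin lb ->
  pad l la = pad l lb -> la = lb.
Proof.
have Posz_inj : injective Posz by move=> a b [].
move=> la0 lb0 /(inj_map Posz_inj) e.
by rewrite -(filter_pad (l - size la) la0) e filter_pad.
Qed.

Lemma nth_pad l la i : nth 0 (pad l la) i = (nth 0%N la i)%:Z.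
Proof.
have -> : (nth 0%N la i)%:Z = (nth 0%N (la ++ nseq (l - size la) 0%N) i)%:Z.
  rewrite nth_cat nth_nseq; case: ltnP => [//|il].
  by rewrite nth_default //; case: ifP.
rewrite /pad; have [il|il] := ltnP i (size (la ++ nseq (l - size la) 0%N)).
  by rewrite (nth_map 0%N).
by rewrite !nth_default // size_map.
Qed.

Lemma subpart_size (la nu : seq nat) : 0%N \notin la -> subpart la nu ->
  (size la <= size nu)%N.
Proof.
move=> la0 lanu; rewrite leqNgt; apply/negP => nula; move: la0.
rewrite -has_pred1; case/hasP; exists (nth 0%N la (size nu)).
  exact: mem_nth.
by have := lanu (size nu); rewrite [X in (_ <= X)%N]nth_default // leqn0.
Qed.

(** Padding with zeros embeds these partitions into the compositions of w. *)
Lemma finite_subparts w nu : finite_set [set la | is_part w la /\ subpart la nu].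
Proof.
apply: (@sub_finite_set _ _
  [set` [seq [seq x <- tau | x != 0%N] | tau <- comps (size nu) w]]).
  move=> la [/and3P[_ la0 /eqP sla] lanu] /=.
  have szla := subpart_size la0 lanu.
  apply/mapP; exists (la ++ nseq (size nu - size la) 0%N).
    rewrite mem_comps size_cat size_nseq subnKC // eqxx sumn_cat sumn_nseq.
    by rewrite mul0n addn0 sla eqxx.
  by rewrite filter_pad.
exact: finite_seq.
Qed.

Lemma tail0_set_pair l x i s r : (i.+1 < l)%N ->
  tail l (set_pair x i s r) 0 = tail l x 0 - x i - x i.+1 + s + r.
Proof.
move=> il; pose oi := Ordinal (ltnW il); pose oj := Ordinal il.
have ne : oj != oi by rewrite -val_eqE /= gtn_eqF.
have E y : tail l y 0 = y i + y i.+1 +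
    \sum_(a < l | (a != oi) && (a != oj)) y a.
  by rewrite /tail big_mkord (bigD1 oi) // (bigD1 oj) //= addrA.
rewrite !E [X in _ + X = _](eq_bigr (fun a : 'I_l => x a)) => [|a]; last first.
  by rewrite -!val_eqE /= /set_pair => /andP[/negbTE -> /negbTE ->].
rewrite /set_pair eqxx (gtn_eqF (ltnSn i)) eqxx.
move: (\sum_(_ < _ | _) _) => y; ring.
Qed.

Section StraighteningSum.
Context (F : fieldType) (t : F) (pick : seq int -> nat).
Hypothesis pickP : procedure pick.
Context (V : lmodType F) (R : (nat -> int) -> V) (nu : seq nat).
Local Notation l := (size nu).
Hypothesis nu_sorted : sorted geq nu.

(** This bound is kept by straightening ([dominated_set_pair]).  It forces the final
    partitions into nu, and it bounds the sums of final entries by the weight of nu,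
    as required for the cut at N. *)
Definition dominated (x : nat -> int) : Prop :=
  forall a, (a < l)%N -> x a <= (nth 0%N nu a)%:Z.

Hypothesis R_tail0 : forall x j, tail l x j < 0 -> R x = 0.
Hypothesis R_straighten : forall i x,
  (i.+1 < l)%N -> x i < x i.+1 -> dominated x ->
  let d := `|x i.+1 - x i|%N in
  R x = \sum_(a < d./2.+1) straight_coef t d a *:
    R (set_pair x i (x i.+1 - a%:Z) (x i + a%:Z)).

Lemma dominated_set_pair i x (a : nat) :
  (i.+1 < l)%N -> x i < x i.+1 -> (a <= `|x i.+1 - x i|./2)%N -> dominated x ->
  dominated (set_pair x i (x i.+1 - a%:Z) (x i + a%:Z)).
Proof.
move=> il xi ad xnu b bl; rewrite /set_pair.
have nui : (nth 0%N nu i.+1 <= nth 0%N nu i)%N.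
  by apply: (sortedP 0%N nu_sorted).
have := xnu _ il; have := xnu _ (ltnW il) => h1 h2.
case: eqP => [->|_]; first by lia.
case: eqP => [->|_]; last exact: xnu.
lia.
Qed.

Lemma nth_S_op_set_pair i a (alpha : seq int) :
  nth 0 (S_op (i, a) alpha) =
  set_pair (nth 0 alpha) i (nth 0 alpha i.+1 - a%:Z) (nth 0 alpha i + a%:Z).
Proof.
apply/funext => b; rewrite nth_S_op /set_pair /=; case: eqP => [->|//].
by rewrite gtn_eqF.
Qed.

Lemma no_ascent_pad (alpha : seq int) : (forall i, ~~ ascent alpha i) ->
  {a | (a < size alpha)%N & nth 0 alpha a < 0} +
  {la | [/\ sorted geq la, 0%N \notin la & alpha = pad (size alpha) la]}.
Proof.
move=> na.
have [neg|pos] := boolP (has (fun x => x < 0) alpha).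
  left; exists (find (fun x => x < 0) alpha); first by rewrite -has_find.
  exact: (nth_find 0 neg).
right; pose s := map absz alpha; exists [seq x <- s | x != 0%N].
have alphaE : alpha = map Posz s.
  rewrite -map_comp -[LHS]map_id; apply/eq_in_map => x xa /=.
  by have := hasPn pos x xa; rewrite -leNgt => /gez0_abs.
have ss : sorted geq s.
  apply/(sortedP 0%N) => i; rewrite size_map => il /=.
  have := na i; rewrite /ascent il -leNgt alphaE.
  by rewrite !(nth_map 0%N) ?size_map // ltnW.
split; first exact: sorted_filter (rev_trans leq_trans) _ _ ss.
  by rewrite mem_filter.
by rewrite {1}alphaE {1}(sorted_geq_pad ss) /pad size_map.
Qed.

(** The induction is on a bound L for the lengths of the admissible words: the words of
    a straightened tuple extend to words of alpha that are longer by one letter. *)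
Lemma straighten_sum_ind L w (P : seq (seq nat)) alpha :
  uniq P -> (forall la, (la \in P) <-> is_part w la /\ subpart la nu) ->
  (forall v, admissible pick v alpha -> (size v < L)%N) ->
  size alpha = l -> dominated (nth 0 alpha) -> tail l (nth 0 alpha) 0 = w%:Z ->
  R (nth 0 alpha) =
  \sum_(la <- P) B_straight t pick la alpha *: R (fun i => (nth 0%N la i)%:Z).
Proof.
move=> Pu PE; elim: L alpha => [|L IH] alpha short sz dom wt.
  by have := short [::] isT.
have [asc|na] := boolP (ascent alpha (pick alpha)); last first.
  have na' i : ~~ ascent alpha i by apply: contra na => /pickP.
  under eq_bigr => la _ do rewrite B_straight_no_ascent //.
  (* A negative entry forces the last entry of a non-increasing tuple to be negative. *)
  case: (no_ascent_pad na') => [[a al neg]|[la [sla la0 alphaE]]].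
    have l0 : (0 < l)%N by rewrite -sz; apply: leq_ltn_trans al.
    rewrite (@R_tail0 _ l.-1) => [|].
      rewrite big1 // => la _; case: eqP => [e|_]; last by rewrite scale0r.
      by move: neg; rewrite e nth_pad.
    rewrite /tail -{2}(prednK l0) big_nat1; apply: le_lt_trans neg.
    have so : sorted (fun x y : int => y <= x) alpha.
      apply/(sortedP 0) => i il; have := na' i.
      by rewrite /ascent il -leNgt.
    apply: (sorted_leq_nth _ _ 0 so) => /=.
    - by move=> x y z yx zy; apply: le_trans zy yx.
    - exact: lexx.
    - by rewrite inE.
    - by rewrite inE sz prednK.
    by move: al; rewrite sz; lia.
  have nthE : nth 0 alpha = fun i => (nth 0%N la i)%:Z.
    by apply/funext => i; rewrite alphaE nth_pad.
  have laP : la \in P.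
    apply/PE; split; last first.
      move=> i; have [il|il] := ltnP i l.
        by have := dom i il; rewrite nthE.
      rewrite nth_default //; apply: leq_trans il; rewrite -sz.
      have := congr1 size alphaE; rewrite /pad size_map size_cat size_nseq => ->.
      exact: leq_addr.
    rewrite /is_part sla la0 /= -(eqr_nat int) !natz -wt nthE.
    rewrite tail_nth0 // -sz.
    have := congr1 size alphaE; rewrite /pad size_map size_cat size_nseq => ->.
    exact: leq_addr.
  rewrite (bigD1_seq la) //= -alphaE eqxx scale1r nthE big_seq_cond big1 ?addr0 //.
  move=> lb /andP[/PE[/and3P[_ lb0 _] _] ne].
  case: eqP => [e|_]; last by rewrite scale0r.
  by case/eqP: ne; apply: (@pad_inj (size alpha)) => //; rewrite -e.
pose i := pick alpha; have /andP[il lt] := asc; rewrite -/i sz in il lt.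
rewrite (R_straighten il lt dom).
under [RHS]eq_big_seq => la /PE[/and3P[sla _ _] _].
  rewrite B_straight_ascent // scaler_suml. over.
rewrite exchange_big /=; apply: eq_bigr => a _.
have ad : (a <= (gap alpha i)./2)%N by rewrite -ltnS.
rewrite -nth_S_op_set_pair (IH (S_op (i, val a) alpha)).
- rewrite scaler_sumr; apply: eq_bigr => la _; by rewrite scalerA.
- move=> v adm; have := short (rcons v (i, val a)).
  by rewrite admissible_rcons /= eqxx asc ad adm size_rcons ltnS; apply.
- by rewrite (size_S_op (ia := (i, val a)) asc).
- by rewrite nth_S_op_set_pair; apply: dominated_set_pair.
rewrite nth_S_op_set_pair tail0_set_pair // wt; lia.
Qed.

Lemma straighten_sum w alpha :
  size alpha = l -> dominated (nth 0 alpha) -> tail l (nth 0 alpha) 0 = w%:Z ->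
  R (nth 0 alpha) =
  \sum_(la <- fset_set [set la | is_part w la /\ subpart la nu])
    B_straight t pick la alpha *: R (fun i => (nth 0%N la i)%:Z).
Proof.
have [L short] : exists L, forall v, admissible pick v alpha -> (size v < L)%N.
  pose W := fset_set [set v | admissible pick v alpha].
  exists (\max_(v <- W) size v).+1 => v adm; rewrite ltnS.
  apply: leq_bigmax_seq => //.
  by rewrite in_fset_set ?inE //; exact: admissible_finite.
apply: (straighten_sum_ind _ _ short); first exact: fset_uniq.
move=> la; rewrite in_fset_set; last exact: finite_subparts.
by rewrite inE.
Qed.
End StraighteningSum.

(** * The recursion *)

Section Recursion.
Context (F : fieldType) (V : comAlgType F) (t : F) (p : nat -> V).
Hypothesis pcharF0 : [pchar F] =i pred0.
Hypothesis t_nonroot : forall k, (0 < k)%N -> 1 - t ^+ k != 0.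
Context (D : nat -> {linear V -> V}).
Hypothesis DM : forall k f g, D k (f * g) = D k f * g + f * D k g.
Hypothesis Dp : forall k n, D k (p n.+1) = (k == n)%:R.
Context (form : V -> V -> F).
Hypothesis form_scalar : forall g, scalar (form^~ g).
Hypothesis formC : forall f g, form f g = form g f.
Hypothesis form_pM : forall k f g,
  form (p k.+1 * f) g = k.+1%:R / (1 - t ^+ k.+1) * form f (D k g).

Local Notation q := (q_coef_int t p).

(** Q_alpha for an arbitrary integer tuple alpha in place of a partition. *)
Definition Q_tuple (N l : nat) : (nat -> int) -> V := raised t N l (prod_at q l).

(** Raising operators act on the indices only, hence commute with the linear form
    <., q_m h> and with the translation by tau. *)
Lemma form_Q_tuple N l x m h :
  form (Q_tuple N l x) (q_coef t p m * h) =
  \sum_(tau <- comps l m) (1 - t) ^+ len tau * form (Q_tuple N l (sub_tuple x tau)) h.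
Proof.
have formE g y : form (Q_tuple N l y) g =
    raise_ops t N (V := F^o) (pairs l) (form^~ g \o prod_at q l) y.
  exact: (raise_ops_scalar _ _ _ _ _ (form_scalar g)).
pose G tau (y : nat -> int) : F^o := form (prod_at q l (sub_tuple y tau)) h.
have wE : (form^~ (q_coef t p m * h) \o prod_at q l : (nat -> int) -> F^o) =
    fun y => \sum_(tau <- comps l m) ((1 - t) ^+ len tau : F) *: G tau y.
  apply/funext => y.
  exact: (form_qprod pcharF0 DM Dp t_nonroot form_scalar formC form_pM).
rewrite formE wE raise_ops_sum; apply: eq_bigr => tau _.
congr (_ * _); rewrite formE.
exact: (@raise_ops_translate F t N F^o _ (form^~ h \o prod_at q l)
          (fun a => (nth 0%N tau a)%:Z)).
Qed.

Lemma Q_tuple_pad N (la : seq nat) l : (0 < N)%N -> (size la <= l)%N ->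
  Q_tuple N l (fun i => (nth 0%N la i)%:Z) =
  Q_tuple N (size la) (fun i => (nth 0%N la i)%:Z).
Proof.
move=> N0 lal; rewrite /Q_tuple -(subnKC lal) raised_prod_at_pad //.
- exact: q_coef_neg.
- exact: q_coef0.
by move=> a laa; rewrite nth_default.
Qed.

Lemma Q_tuple_straighten pick N (nu : seq nat) w alpha : procedure pick ->
  sorted geq nu -> (sumn nu < N)%N -> size alpha = size nu ->
  dominated nu (nth 0 alpha) -> tail (size nu) (nth 0 alpha) 0 = w%:Z ->
  Q_tuple N (size nu) (nth 0 alpha) =
  \sum_(la <- fset_set [set la | is_part w la /\ subpart la nu])
    B_straight t pick la alpha *:
      Q_tuple N (size nu) (fun i => (nth 0%N la i)%:Z).
Proof.
move=> pickP snu nuN; have q_neg := @q_coef_neg F V t p.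
apply: (straighten_sum pickP snu) => [x j|i x il xi xnu].
  by apply: raise_ops_tail0 => // y a; exact: prod_at_supp.
apply: raised_straighten => //.
- by rewrite (natS_neq0 pcharF0).
- exact: leq_ltn_trans nuN.
- by move=> y a; exact: prod_at_supp.
- by move=> j y; exact: prod_at_swap.
apply: (@le_lt_trans _ _ (sumn nu)%:Z); last by rewrite ltz_nat.
rewrite -(@tail_nth0 (size nu)) // /tail (big_cat_nat (leq0n i.+1)) 1?ltnW //=.
apply: (@le_trans _ _ (\sum_(i.+1 <= a < size nu) (nth 0%N nu a)%:Z)).
  by rewrite big_nat [leRHS]big_nat; apply: ler_sum => a /andP[_]; exact: xnu.
by rewrite lerDr; apply: sumr_ge0.
Qed.

(** The recursion before specialization: h is the product of the remaining q's. *)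
Lemma Q_tuple_recursion pick N n m (nu : seq nat) h : procedure pick ->
  is_part n nu -> (n < N)%N -> (m <= n)%N ->
  form (Q_tuple N (size nu) (fun i => (nth 0%N nu i)%:Z)) (q_coef t p m * h) =
  \sum_(la <- fset_set [set la | is_part (n - m) la /\ subpart la nu])
    \sum_(tau <- comps (size nu) m)
      (1 - t) ^+ len tau * B_straight t pick la (tuple_sub nu tau)
        * form (Q_tuple N (size la) (fun i => (nth 0%N la i)%:Z)) h.
Proof.
move=> pickP /and3P[snu _ /eqP nuE] nN mn.
rewrite form_Q_tuple exchange_big /=.
rewrite big_seq [RHS]big_seq; apply: eq_bigr => tau.
rewrite mem_comps => /andP[/eqP sz /eqP sm].
have szt : size (tuple_sub nu tau) = size nu.
  by rewrite size_map size_zip sz minnn.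
have nthE : sub_tuple (fun i => (nth 0%N nu i)%:Z) tau = nth 0 (tuple_sub nu tau).
  apply/funext => i; rewrite /sub_tuple.
  have [il|il] := ltnP i (size nu); last by rewrite !nth_default ?szt ?sz.
  by rewrite (nth_map (0%N, 0%N)) ?size_zip ?sz ?minnn // nth_zip.
rewrite nthE (Q_tuple_straighten (w := n - m) pickP) ?nuE //; last first.
- rewrite -nthE /tail sumrB -/(tail _ _ 0) tail_nth0 // -[X in _ - X]/(tail _ _ 0).
  by rewrite tail_nth0 ?sz // nuE sm subzn.
- by move=> i il; rewrite -nthE /sub_tuple gerBl.
rewrite (scalar_sum _ _ _ _ (form_scalar h)) mulr_sumr.
rewrite big_seq [RHS]big_seq; apply: eq_bigr => la.
rewrite in_fset_set ?inE; last exact: finite_subparts.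
move=> [/and3P[_ la0 _] lanu]; rewrite mulrA Q_tuple_pad //; first by lia.
exact: subpart_size.
Qed.
End Recursion.

Section HallLittlewood.
Context (F : fieldType) (t : F).

Lemma hl_q_intE : hl_q_int t = q_coef_int t (psum F).
Proof. by apply/funext => -[]. Qed.

Lemma hl_QE (la : seq nat) N : (sumn la < N)%N ->
  hl_Q t la = Q_tuple t (psum F) N (size la) (fun i => (nth 0%N la i)%:Z).
Proof.
move=> laN; rewrite /Q_tuple -hl_q_intE.
apply: etrans (raising_sum t _ laN) => //; first by case.
Qed.

Hypothesis pcharF0 : [pchar F] =i pred0.
Hypothesis t_nonroot : forall k, (0 < k)%N -> 1 - t ^+ k != 0.

Lemma hl_B_recursion pick n (mu nu : seq nat) : procedure pick ->
  (0 < n)%N -> is_part n mu -> is_part n nu ->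
  hl_B t nu mu =
  \sum_(la \in [set la | is_part (n - head 0%N mu) la /\ subpart la nu])
    \sum_(tau \in [set tau : seq nat |
                     size tau = size nu /\ sumn tau = head 0%N mu])
      (1 - t) ^+ len tau
        * B_straight t pick la (tuple_sub nu tau)
        * hl_B t la (behead mu).
Proof.
move=> pickP n0 /and3P[_ _ /eqP muE] hnu.
case: mu muE => [|m mu] /= muE; first by rewrite -muE in n0.
have nuE : sumn nu = n by case/and3P: hnu => _ _ /eqP.
have mn : (m <= n)%N by rewrite -muE leq_addr.
rewrite fsbig_finite; last exact: finite_subparts.
rewrite /hl_B (@hl_QE nu n.+1) ?nuE // /hl_q_part big_cons.
have -> : hl_q t m = q_coef t (psum F) m by [].
rewrite (Q_tuple_recursion pcharF0 t_nonroot (D := fun k => pder k)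
  (@pderM F) (@pder_psum F) (@hl_form_scalar F t) (@hl_formC F t)
  (@hl_form_psumM F t) _ pickP hnu (ltnSn n) mn).
rewrite big_seq [RHS]big_seq; apply: eq_bigr => la.
rewrite in_fset_set ?inE; last exact: finite_subparts.
move=> [/and3P[_ _ /eqP laE] _].
rewrite -(@hl_QE la n.+1) ?laE; last by rewrite ltnS leq_subr.
rewrite [LHS]fsbig_seq ?uniq_comps //; apply: eq_fsbigl.
apply/seteqP; split => tau /=; rewrite mem_comps.
  by move=> /andP[/eqP -> /eqP ->].
by move=> [-> ->]; rewrite !eqxx.
Qed.
End HallLittlewood.

Lemma pchar_Qt : [pchar Qt] =i pred0.
Proof.
apply/(pcharf0P Qt) => k.
rewrite -(rmorph_nat (@tofrac {poly rat}) k) tofrac_eq0.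
by rewrite -polyC_natr polyC_eq0 pnatr_eq0.
Qed.

Lemma tvar_nonroot k : (0 < k)%N -> 1 - tvar ^+ k != 0.
Proof.
case: k => // k _; rewrite /tvar -rmorphXn -(rmorph1 (@tofrac {poly rat})) -rmorphB.
rewrite tofrac_eq0; apply: contra_neq (oner_neq0 rat) => X0.
have := congr1 (coefp 0) X0.
by rewrite /= coefB coef1 coefXn subr0 coef0.
Qed.

Unset Implicit Arguments.

Theorem theorem4p5 (pick : seq int -> nat) (hpick : procedure pick)
    (n : nat) (hn : (0 < n)%N) (mu nu : seq nat)
    (hmu : is_part n mu) (hnu : is_part n nu) :
  hl_B tvar nu mu =
  \sum_(la \in [set la | is_part (n - head 0%N mu) la /\ subpart la nu])
    \sum_(tau \in [set tau : seq nat |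
                     size tau = size nu /\ sumn tau = head 0%N mu])
      (1 - tvar) ^+ len tau
        * B_straight tvar pick la (tuple_sub nu tau)
        * hl_B tvar la (behead mu).
Proof. exact: (hl_B_recursion pchar_Qt tvar_nonroot hpick hn hmu hnu). Qed.
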